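(* Let $n\ge 2$, let $I\subset R$ be a complete intersection of codimension $n$ with homogeneous generators of degrees $d_1\le\cdots\le d_n$, let $K\subset I$ be generated by a regular sequence of length $n$ of homogeneous elements all of the same degree $e$, let $J=(K:I)$, and assume that the dual mapping cone resolution $\mathbf P$ of $R/J$ (described in the context) is minimal. If $m_{n-1}=(n-1)e$, then $$e(R/J)\ge\frac{\prod_{i=1}^n m_i}{n!},$$ where $m_i$ is the minimal shift in the $i$-th step of the minimal graded free resolution of $R/J$.
   Context: $R$ is a standard graded polynomial ring over a field, and $e(R/J)$ denotes the multiplicity of $R/J$ (while $e$ alone denotes the common degree of the generators of $K$). The inclusion $K\subset I$ induces a map $\phi$ from the Koszul resolution of $R/K$ to the Koszul resolution of $R/I$; the mapping cone of its dual (with the identity component in homological degree $0$ of $\phi$ cancelled) is a graded free resolution $\mathbf P$ of $R/J$ with $P_0=R$, $$P_i=R(-ie)^{\binom ni}\oplus\bigoplus_{|T|=n-i+1}R\Big(-\big(ne-\sum_{t\in T}d_t\big)\Big)\quad(1\le i\le n-1),\qquad P_n=\bigoplus_{t=1}^nR(-(ne-d_t)),$$ where $T$ ranges over subsets of $\{1,\dots,n\}$. One has $e\ge d_i$ for all $i$. When $\mathbf P$ is minimal, the minimal shifts are $m_i=\min\{ie,\ ne-\sum_{j=i}^n d_j\}$ for $1\le i\le n-1$ and $m_n=ne-d_n$. *)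

(* Defs.v *)
From HB Require Import structures.
From mathcomp Require Import all_boot all_order all_algebra.
From mathcomp.multinomials Require Import mpoly.

Set Implicit Arguments.
Unset Strict Implicit.
Unset Printing Implicit Defensive.

Import Order.TTheory GRing.Theory Num.Theory.
Local Open Scope ring_scope.

Section Defs.
Variables (k : fieldType) (r : nat).
Local Notation R := {mpoly k[r]}.

(* Homogeneity in an integer degree: only 0 is homogeneous of negative
   degree (and 0 is homogeneous of every degree). *)
Definition homogz (a : int) (p : R) : Prop :=
  match a with
  | Posz m => p \is m.-homog
  | Negz _ => p = 0
  end.

Definition ideal_of n (P : pred 'I_n) (g : 'I_n -> R) (p : R) : Prop :=
  exists c : 'I_n -> R, p = \sum_(j | P j) c j * g j.

Definition ideal_gen n (g : 'I_n -> R) : R -> Prop := ideal_of predT g.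

Definition colon (K I : R -> Prop) (p : R) : Prop :=
  forall q, I q -> K (p * q).

(* The second clause makes the generated ideal proper, so that homogeneous
   members of a regular sequence have positive degree. *)
Definition regular_sequence n (g : 'I_n -> R) : Prop :=
  (forall (i : 'I_n) (p : R),
      ideal_of (fun j : 'I_n => (j < i)%N) g (p * g i) ->
      ideal_of (fun j : 'I_n => (j < i)%N) g p)
  /\ ~ ideal_gen g 1.

(* h is the k-dimension of the degree-t component of R/J: the family b is a
   k-basis of R_t modulo J. *)
Definition graded_dim (J : R -> Prop) (t h : nat) : Prop :=
  exists b : 'I_h -> R,
    [/\ forall i, b i \is t.-homog,
        forall c : 'I_h -> k, J (\sum_i c i *: b i) -> forall i, c i = 0
      & forall p : R, p \is t.-homog ->
          exists c : 'I_h -> k, J (p - \sum_i c i *: b i)].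

(* With p the Hilbert polynomial of R/J: if p != 0 then deg p = dim R/J - 1 and
   the multiplicity is (deg p)! times the leading coefficient; if p = 0 then
   R/J has finite length and its multiplicity is that length. *)
Definition is_multiplicity (J : R -> Prop) (mu : rat) : Prop :=
  exists (H : nat -> nat) (p : {poly rat}) (t0 : nat),
    [/\ forall t, graded_dim J t (H t),
        forall t, (t0 <= t)%N -> p.[t%:R] = (H t)%:R
      & mu = if p == 0 then (\sum_(t < t0) H t)%:R
             else ((size p).-1)`!%:R * lead_coef p].

(* Homologically graded sequences of finite free graded modules with bases:
   F_i is the direct sum of the R(-shift b), b in gbasis i, and the basis
   element b of F_(i+1) is sent to \sum_c gdiff b c * e_c. *)
Record gfree := GFree {
  gbasis : nat -> finType;
  gshift : forall i, gbasis i -> int;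
  gdiff  : forall i, gbasis i.+1 -> gbasis i -> R }.

Definition gmap (F : gfree) i (u : {ffun gbasis F i.+1 -> R}) :
    {ffun gbasis F i -> R} :=
  [ffun c => \sum_b u b * gdiff b c].

Definition graded (F : gfree) : Prop :=
  forall i (b : gbasis F i.+1) (c : gbasis F i),
    homogz (gshift b - gshift c) (gdiff b c).

(* d(F_(i+1)) is contained in (x_1, ..., x_r) F_i *)
Definition minimal (F : gfree) : Prop :=
  forall i (b : gbasis F i.+1) (c : gbasis F i), (gdiff b c)@_0%MM = 0.

(* Exactness of ... -> F_1 -> F_0 -> R/J -> 0, where the augmentation sends the
   basis element b of F_0 to the class of the homogeneous polynomial aug b. *)
Definition resolves (F : gfree) (J : R -> Prop) : Prop :=
  exists aug : gbasis F 0 -> R,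
    [/\ forall b, homogz (gshift b) (aug b),
        forall p : R, exists u : {ffun gbasis F 0 -> R},
          J (p - \sum_b u b * aug b),
        forall u : {ffun gbasis F 0 -> R},
          J (\sum_b u b * aug b) <-> exists v, u = gmap v
      & forall i (u : {ffun gbasis F i.+1 -> R}),
          gmap u = 0 <-> exists v, u = gmap v].

Definition minimal_graded_free_resolution (F : gfree) (J : R -> Prop) : Prop :=
  [/\ graded F, minimal F & resolves F J].

Definition minimal_shift (F : gfree) (i : nat) (m : int) : Prop :=
  (exists b : gbasis F i, gshift b = m) /\
  (forall b : gbasis F i, m <= gshift b).

Section Koszul.
Variable n : nat.
Implicit Types S T : {set 'I_n}.

(* Coefficient of e_T in d(e_S) in the Koszul complex on g, whose degree-i
   part has basis the e_S with #|S| = i. *)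
Definition kosz (g : 'I_n -> R) S T : R :=
  \sum_(s in S | S :\ s == T) (-1) ^+ #|[set t in S | (t < s)%N]| * g s.

(* phi S T, for #|S| = #|T|, is the coefficient of e_T in the image of e_S; the
   other values of phi are irrelevant.  phi is a graded chain map from the
   Koszul complex on f (generators of degree e) to the one on g (generators of
   degrees d), and lifts the projection R/(f) -> R/(g) by the identity of R. *)
Definition koszul_comparison (f g : 'I_n -> R) (e : nat) (d : 'I_n -> nat)
    (phi : {set 'I_n} -> {set 'I_n} -> R) : Prop :=
  [/\ phi set0 set0 = 1,
      forall S T, #|S| = #|T| ->
        homogz ((#|S| * e)%N%:Z - (\sum_(t in T) d t)%N%:Z) (phi S T)
    & forall S T, #|S| = #|T|.+1 ->
        \sum_(S' : {set 'I_n} | #|S'| == #|T|) kosz f S S' * phi S' T =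
        \sum_(T' : {set 'I_n} | #|T'| == #|S|) phi S T' * kosz g T' T].

(* The mapping cone of the dual phi^* : K(g)^* -> K(f)^*, twisted by -n e and
   placed so that its degree-i part is K_(n-i)(f)^* + K_(n-i+1)(g)^*, with
   bases the S with #|S| = n - i (left) and the T with #|T| = n - i + 1
   (right).  The component phi_0^* = 1 maps the right basis element set0, in
   degree n + 1, to the left one, in degree n.  Cancelling it means dividing by
   the right element a = set0 and by d(a), that is, by a and by the left element
   set0 plus a combination of the right singletons: the singletons remain a
   basis of the degree-n part and their differential is unchanged.  Thus the
   cancellation just deletes both basis elements set0. *)
Definition cone_basis (i : nat) : finType :=
  ({S : {set 'I_n} | (#|S| + i == n)%N && (S != set0)} +
   {T : {set 'I_n} | (#|T| + i == n.+1)%N && (T != set0)})%type.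

Definition cone_shift (e : nat) (d : 'I_n -> nat) i (b : cone_basis i) : int :=
  match b with
  | inl _ => (i * e)%N%:Z
  | inr T => (n * e)%N%:Z - (\sum_(t in val T) d t)%N%:Z
  end.

Definition cone_diff (f g : 'I_n -> R) (phi : {set 'I_n} -> {set 'I_n} -> R)
    i (b : cone_basis i.+1) (c : cone_basis i) : R :=
  match b, c with
  | inl A, inl A' => kosz f (val A') (val A)
  | inl _, inr _ => 0
  | inr B, inl A => phi (val A) (val B)
  | inr B, inr B' => - kosz g (val B') (val B)
  end.

Definition dual_mapping_cone (f g : 'I_n -> R) (e : nat) (d : 'I_n -> nat)
    (phi : {set 'I_n} -> {set 'I_n} -> R) : gfree :=
  @GFree cone_basis (@cone_shift e d) (@cone_diff f g phi).

End Koszul.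
End Defs.

(* Main.v *)
Require Import Defs.
From HB Require Import structures.
From mathcomp Require Import all_boot all_order all_algebra.
From mathcomp.multinomials Require Import mpoly.
From mathcomp Require Import zify ring.
From Stdlib Require Import ClassicalEpsilon.

(** Why the theorem holds.

    Write I = (g), K = (f), J = K : I and Delta for the top entry of the comparison map
    phi; when phi is made of the exterior powers of a matrix expressing f in terms of g,
    Delta is the determinant of that matrix.

    Koszul complexes of regular sequences are acyclic ([koszul_exact]) and self-dual
    ([koszul_delta_star]), so their duals resolve R/I and R/K too, and phi dualizes to a
    lift of the multiplication by Delta from R/I to R/K. The comparison theorem for
    resolutions then gives K : Delta = I ([colon_Delta_sub], [Delta_colon]) and
    J = K + (Delta) ([colonP]). Two consequences follow.

    First, the dual mapping cone is exact and resolves R/J ([cone_exact],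
    [cone_resolves]). It is minimal by assumption, and two minimal graded resolutions of
    the same module have the same shifts in each degree ([shift_transfer]); so the shifts
    of F are those of the cone. Testing well-chosen basis elements gives m_i <= i e for
    i < n, m_n <= n e - d_n, and (n - 1) e = m_(n-1) <= n e - d_(n-1) - d_n, that is
    d_(n-1) + d_n <= e. Hence d_i <= e / 2 for i < n.

    Second, there is an exact sequence 0 -> R/I(-s) -> R/K -> R/J -> 0 with s the degree
    of Delta. A complete intersection of degrees a_1, ..., a_n has Hilbert series
    prod (1 + X + ... + X^(a_i - 1)) / (1 - X)^(r - n)
    ([hilbert_series_complete_intersection]), so R/J has a Hilbert series with the same
    denominator and with a numerator of value e^n - prod d_i at X = 1
    ([hilbert_series_add]). This value is positive, hence it is the multiplicity
    ([hilbert_series_multiplicity]).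

    It remains to compare: the product of the m_i divided by n! is at most
    e^n - e^(n-1) d_n / n, while prod d_i <= (e / 2)^(n-1) d_n <= e^(n-1) d_n / n because
    n <= 2^(n-1) ([multiplicity_bound]). *)

Set Implicit Arguments.
Unset Strict Implicit.
Unset Printing Implicit Defensive.

Import Order.TTheory GRing.Theory Num.Theory.
Local Open Scope ring_scope.

(** * The Koszul complex of a regular sequence *)

Section Koszul.
Variables (R : comNzRingType) (n : nat) (g : 'I_n -> R).
Implicit Types (S T : {set 'I_n}) (s t : 'I_n) (u v : {set 'I_n} -> R).

Definition koszul_sign s T : R := (-1) ^+ #|[set t in T | (t < s)%N]|.

Lemma koszul_signU1 s t T : t \notin T ->
  koszul_sign s (t |: T) = (-1) ^+ (t < s)%N * koszul_sign s T.
Proof.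
move=> tT; rewrite /koszul_sign -exprD; congr (_ ^+ _).
have -> : [set x in t |: T | (x < s)%N] =
  (if (t < s)%N then [set t] else set0) :|: [set x in T | (x < s)%N].
  apply/setP=> x; rewrite !inE; case: ifP => h; rewrite !inE.
    by case: eqVneq => [->|_] //=; rewrite h.
  by case: eqVneq => [->|_] //=; rewrite h andbF.
case: ifP => h /=; last by rewrite set0U.
by rewrite cardsU1 inE (negPf tT).
Qed.

Lemma koszul_signU1_id s T : koszul_sign s (s |: T) = koszul_sign s T.
Proof.
case: (boolP (s \in T)) => sT; last by rewrite koszul_signU1 // ltnn mul1r.
by rewrite (setUidPr _) // sub1set.
Qed.

(** Vectors are indexed by all subsets at once. [koszul_d] is the boundary of the Koszul
    complex on [g], the coefficient at [T] of the image of [\sum_S u S e_S];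
    [koszul_delta] is the transposed map, the Koszul codifferential. *)
Definition koszul_d u T : R := \sum_(s | s \notin T) koszul_sign s T * g s * u (s |: T).

Definition koszul_delta u S : R := \sum_(s in S) koszul_sign s S * g s * u (S :\ s).

Lemma eq_koszul_d u v : u =1 v -> koszul_d u =1 koszul_d v.
Proof. by move=> e T; apply: eq_bigr => s _; rewrite e. Qed.

Lemma koszul_dD u v T : koszul_d (fun S => u S + v S) T = koszul_d u T + koszul_d v T.
Proof. by rewrite /koszul_d -big_split; apply: eq_bigr => s _; rewrite mulrDr. Qed.

Lemma koszul_dB u v T : koszul_d (fun S => u S - v S) T = koszul_d u T - koszul_d v T.
Proof. by rewrite /koszul_d -sumrB; apply: eq_bigr => s _; rewrite mulrBr. Qed.

(** The terms removing [s] then [t] and [t] then [s] cancel, as the sign of the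
    larger index sees the smaller one. *)
Lemma koszul_d_d u T : koszul_d (koszul_d u) T = 0.
Proof.
pose F s t := koszul_sign s T * g s * (koszul_sign t (s |: T) * g t) * u (t |: (s |: T)).
have asym s t : s \notin T -> t \notin T -> (s < t)%N -> F s t = - F t s.
  move=> sT tT lt; rewrite /F !koszul_signU1 // lt ltnNge (ltnW lt) expr1 expr0 setUCA; ring.
have -> : koszul_d (koszul_d u) T =
    \sum_(s | s \notin T) \sum_(t | (t \notin T) && (t != s)) F s t.
  rewrite /koszul_d; apply: eq_bigr => s _; rewrite /koszul_d mulr_sumr.
  apply: eq_big => [t|t _]; first by rewrite in_setU1 negb_or andbC.
  by rewrite mulrA.
rewrite (eq_bigr (fun s => \sum_(t | (t \notin T) && (t < s)%N) F s t
            + \sum_(t | (t \notin T) && (s < t)%N) F s t)); last first.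
  move=> s _; rewrite (bigID (fun t : 'I_n => (t < s)%N)) /=; congr (_ + _);
    apply: eq_bigl => t; rewrite -val_eqE /=; case: (t \in T) => //=; lia.
rewrite big_split /= (exchange_big_dep (fun s => s \notin T)) => [|s t _ /andP[]//] /=.
rewrite -big_split /= big1 // => s sT.
rewrite (eq_bigl (fun t => (t \notin T) && (s < t)%N)) => [|t]; last by rewrite sT.
by rewrite -big_split /= big1 // => t /andP[tT lt]; rewrite (asym s t) // addrN.
Qed.

(** Vectors of the Koszul complex on the first [j] elements. *)
Definition supported_below (j : nat) u := forall S s, s \in S -> (j <= s)%N -> u S = 0.

Lemma koszul_d_supported j u : supported_below j u -> supported_below j (koszul_d u).
Proof.
move=> su S s sS js; rewrite /koszul_d big1 // => t _.
by rewrite (su (t |: S) s) ?mulr0 // !inE sS orbT.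
Qed.

(** Writing [u = a + e_x b] with [x] the largest index in use, [d u] has components
    [d a +- g_x b] and [d b]: the Koszul complex on [x.+1] elements is the mapping cone
    of multiplication by [g_x] on the complex on [x] elements. *)
Lemma koszul_d_last (x : 'I_n) u (T : {set 'I_n}) : supported_below x.+1 u ->
    (forall t, t \in T -> (t < x)%N) ->
  koszul_d u T = (-1) ^+ #|T| * g x * u (x |: T)
           + koszul_d (fun S => if x \in S then 0 else u S) T /\
  koszul_d u (x |: T) = koszul_d (fun S => if x \in S then 0 else u (x |: S)) T.
Proof.
move=> su hT.
have xT : x \notin T by apply/negP => /hT; rewrite ltnn.
split.
  rewrite /koszul_d (bigD1 x) //= [X in _ = _ + X](bigD1 x) //= setU11 mulr0 add0r.
  congr (_ * _ * _ + _).
    by rewrite /koszul_sign; congr (_ ^+ _); apply: eq_card => t; rewrite inE;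
       case: (boolP (t \in T)) => // /hT ->.
  apply: eq_bigr => s /andP[_ sx].
  by rewrite in_setU1 eq_sym (negPf sx) (negPf xT).
rewrite /koszul_d [RHS](bigD1 x) //= setU11 mulr0 add0r.
apply: eq_big => [s|s]; first by rewrite in_setU1 negb_or andbC.
rewrite in_setU1 negb_or => /andP[sx sT].
rewrite in_setU1 eq_sym (negPf sx) (negPf xT) setUCA /=.
have [xs|] := leqP x s; last by move=> lt; rewrite koszul_signU1 // ltnNge (ltnW lt) mul1r.
have lt : (x < s)%N by rewrite ltn_neqAle xs eq_sym val_eqE sx.
by rewrite (su _ s) ?mulr0 // !inE eqxx !orbT.
Qed.

Definition singleton_vector (P : pred 'I_n) (c : 'I_n -> R) S : R :=
  \sum_(s | P s && (S == [set s])) c s.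

Lemma koszul_d_singleton P c T :
  koszul_d (singleton_vector P c) T = if T == set0 then \sum_(s | P s) c s * g s else 0.
Proof.
rewrite /koszul_d; case: eqVneq => [->|T0].
  rewrite [RHS]big_mkcond; apply: eq_big => [s|s _]; first by rewrite inE.
  have -> : koszul_sign s set0 = 1.
    by rewrite /koszul_sign (eq_card0 (A := mem [set t in set0 | _])) // => t; rewrite !inE.
  rewrite setU0 mul1r /singleton_vector; case: ifP => Ps.
    rewrite mulrC; congr (_ * _); apply: big_pred1 => t.
    rewrite /= (inj_eq set1_inj) [s == t]eq_sym.
    by case: (eqVneq t s) => [->|_]; rewrite ?Ps ?andbF.
  rewrite big1 ?mulr0 // => t /andP[Pt /eqP/set1_inj st].
  by rewrite st Pt in Ps.
rewrite big1 // => s sT; rewrite /singleton_vector big1 ?mulr0 // => t /andP[_ /eqP e].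
case/set0Pn: T0 => y yT; case/negP: sT.
have : y \in [set t] by rewrite -e !inE yT orbT.
have : s \in [set t] by rewrite -e setU11.
by rewrite !inE => /eqP -> /eqP <-.
Qed.

Definition drop_set0 u S : R := if S == set0 then 0 else u S.

Lemma koszul_d_drop_set0 u : koszul_d (drop_set0 u) =1 koszul_d u.
Proof.
move=> T; rewrite /koszul_d; apply: eq_bigr => s _; rewrite /drop_set0.
by case: eqP => // /setP/(_ s); rewrite !inE eqxx.
Qed.

Lemma koszul_d_set0 u : koszul_d u set0 = \sum_s u [set s] * g s.
Proof.
rewrite /koszul_d; apply: eq_big => [s|s _]; first by rewrite inE.
rewrite setU0 /koszul_sign (eq_card0 (A := mem [set t in set0 | _])) ?mul1r 1?mulrC //.
by move=> t; rewrite !inE.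
Qed.

Hypothesis reg : forall (x : 'I_n) (p : R),
  (exists c, p * g x = \sum_(s : 'I_n | (s < x)%N) c s * g s) ->
  exists c, p = \sum_(s : 'I_n | (s < x)%N) c s * g s.

(** Acyclicity of the Koszul complex of a regular sequence, by induction on the number
    of elements in use. With [u = a + e_x b], the component [b] is a cycle, and up to
    its value at [set0] it is a boundary; regularity of [g_x] takes care of that
    value. Hence [u] differs from a cycle on fewer elements by a boundary. *)
Lemma koszul_exact_below j u : (j <= n)%N -> supported_below j u -> u set0 = 0 ->
  (forall T, koszul_d u T = 0) ->
  exists2 v, supported_below j v & forall T, u T = koszul_d v T.
Proof.
elim: j u => [|j IH] u jn su u0 du.
  exists (fun=> 0) => // T; rewrite /koszul_d big1 => [|s _]; last by rewrite mulr0.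
  by have [->//|/set0Pn[s sT]] := eqVneq T set0; apply: (su T s).
pose x := Ordinal jn.
pose lt T := [forall t in T, t < x]%N.
have ltP T : reflect (forall t, t \in T -> (t < x)%N) (lt T) by apply: forall_inP.
have notlt T : ~~ lt T -> exists2 t, t \in T & (x <= t)%N.
  by case/forall_inPn=> t tT h; exists t => //; rewrite leqNgt.
pose b S := if x \in S then 0 else u (x |: S).
have bs : supported_below j b.
  move=> S s sS js; rewrite /b; case: ifP => // xS; rewrite (su _ s) //.
    by rewrite !inE sS orbT.
  rewrite ltn_neqAle js andbT; apply: contraFneq xS => e.
  by have <- : s = x by apply: val_inj.
have db T : koszul_d b T = 0.
  have [h|/notlt[t tT h]] := boolP (lt T); last exact: (koszul_d_supported bs tT).
  by have [_ <-] := koszul_d_last (x := x) su (ltP _ h).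
pose a S := if x \in S then 0 else u S.
(* In degree 0 the equation d u = 0 says that b(set0) * g_x is a combination of
   the earlier g_s; regularity makes b(set0) such a combination. *)
have [c hc] : exists c, b set0 = \sum_(s : 'I_n | (s < x)%N) c s * g s.
  apply: reg; exists (fun s => - a [set s]).
  have h0 t : t \in (set0 : {set 'I_n}) -> (t < x)%N by rewrite inE.
  have [] := koszul_d_last (x := x) su h0; rewrite du cards0 expr0 mul1r => /esym/eqP.
  rewrite addrC addr_eq0 -/a koszul_d_set0 => /eqP e _.
  have -> : b set0 * g x = - (- (g x * u (x |: set0))).
    by rewrite opprK mulrC /b inE.
  rewrite -e -sumrN [LHS](bigID (fun s : 'I_n => (s < x)%N)) /=.
  rewrite [X in _ + X]big1 ?addr0 => [|s sx].
    by apply: eq_bigr => s _; rewrite mulNr.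
  rewrite /a in_set1; case: eqVneq => [_|xs]; first by rewrite mul0r oppr0.
  rewrite (su _ s) ?mul0r ?oppr0 ?set11 //.
  have xs' : (x : nat) != s by rewrite val_eqE.
  by rewrite ltn_neqAle xs' leqNgt.
(* w is a vector of degree 1 with boundary b(set0), so b - d w is a cycle
   vanishing at set0. *)
pose w := singleton_vector (fun s => (s < x)%N) c.
have dw T : koszul_d w T = if T == set0 then b set0 else 0 by rewrite koszul_d_singleton -hc.
have ws : supported_below j w.
  move=> S s sS js; rewrite /w /singleton_vector big1 // => t /andP[tx /eqP e].
  by move: sS; rewrite e inE => /eqP e'; move: tx; rewrite -e' ltnNge js.
have [v0 v0s hv0] : exists2 v, supported_below j v &
    forall T, b T - koszul_d w T = koszul_d v T.
  apply: IH; first exact: ltnW.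
  - by move=> S s sS js; rewrite (koszul_d_supported ws sS js) (bs S s) ?subr0.
  - by rewrite dw eqxx subrr.
  - by move=> T; rewrite koszul_dB db koszul_d_d subr0.
pose v := drop_set0 (fun S => v0 S + w S).
have vs : supported_below j v.
  by move=> S s sS js; rewrite /v /drop_set0 (v0s S s) ?(ws S s) // addr0 if_same.
have hv T : b T = koszul_d v T by rewrite koszul_d_drop_set0 koszul_dD -hv0 subrK.
(* y = e_x v: subtracting d y from u removes its e_x-component. *)
pose y S := if x \in S then v (S :\ x) else 0.
have ys : supported_below j.+1 y.
  move=> S s sS js; rewrite /y; case: ifP => // xS.
  rewrite (vs _ s) ?(ltnW js) // !inE sS andbT.
  by apply: contraTneq js => ->; rewrite -leqNgt.
have y_in T : x \notin T -> y (x |: T) = v T.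
  by move=> xT; rewrite /y setU11 setU1K.
have [v1 v1s hv1] : exists2 v1, supported_below j v1 &
    forall T, u T - koszul_d y T = koszul_d v1 T.
  apply: IH; first exact: ltnW.
  - move=> S s sS js.
    have [h|] := ltnP j s.
      by rewrite (su S s) // (koszul_d_supported ys sS) // subr0.
    move=> sj; have es : s = x by apply: val_inj; apply/eqP; rewrite eqn_leq js andbT.
    rewrite -(setD1K sS) es; set T := S :\ x.
    have xT : x \notin T by rewrite setD11.
    have [h|/notlt[t tT h]] := boolP (lt T).
      have [_ ->] := koszul_d_last (x := x) ys (ltP _ h).
      have -> : u (x |: T) = b T by rewrite /b (negPf xT).
      rewrite hv; apply/eqP; rewrite subr_eq0; apply/eqP; apply: eq_koszul_d => A.
      case: ifP => xA; last by rewrite y_in ?xA.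
      by rewrite (vs A x).
    have xt : (j < t)%N.
      by rewrite ltn_neqAle h andbT; apply: contraNneq xT => e;
         have -> : x = t by apply: val_inj.
    have tS : t \in x |: T by rewrite setU1r.
    by rewrite (su _ t tS xt) (koszul_d_supported ys tS xt) subrr.
  - rewrite u0 sub0r.
    have h0 t : t \in (set0 : {set 'I_n}) -> (t < x)%N by rewrite inE.
    have [-> _] := koszul_d_last (x := x) ys h0; rewrite y_in ?inE //.
    rewrite /v /drop_set0 eqxx mulr0 add0r.
    rewrite /koszul_d big1 ?oppr0 // => s _; rewrite /y.
    by case: (x \in _); rewrite mulr0.
  - by move=> T; rewrite koszul_dB du koszul_d_d subr0.
exists (fun S => v1 S + y S) => [S s sS js|T].
  by rewrite (v1s S s) ?(ltnW js) // (ys S s) ?addr0.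
by rewrite koszul_dD -hv1 subrK.
Qed.

Lemma koszul_exact u : u set0 = 0 -> (forall T, koszul_d u T = 0) ->
  exists v, forall T, u T = koszul_d v T.
Proof.
move=> u0 du; have [||//|v _ hv] := @koszul_exact_below n u (leqnn n); last by exists v.
- by move=> S s _ /leq_ltn_trans/(_ (ltn_ord s)); rewrite ltnn.
- exact: u0.
Qed.

(** The sign which makes [e_S |-> e_(~: S)] an isomorphism from the Koszul cochain
    complex to the Koszul chain complex. *)
Definition star_sign S : R := (-1) ^+ (\sum_(s in S) s).

Lemma star_signK S : star_sign S * star_sign S = 1.
Proof. by rewrite /star_sign -exprD addnn -muln2 mulnC exprM sqrrN expr1n expr1n. Qed.

(** Self-duality of the Koszul complex: removing [s] from [S] and adding it to [~: S]
    carry signs whose product is [(-1) ^+ s], which is also the ratio of the star signs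
    of [S] and [S :\ s]. *)
Lemma koszul_delta_star u S : koszul_delta u S =
  star_sign S * koszul_d (fun T => star_sign (~: T) * u (~: T)) (~: S).
Proof.
rewrite /koszul_delta /koszul_d mulr_sumr.
apply: eq_big => [s|s sS]; first by rewrite !inE negbK.
have -> : ~: (s |: ~: S) = S :\ s.
  by apply/setP=> t; rewrite !inE negb_or negbK.
have e1 : star_sign S = (-1) ^+ s * star_sign (S :\ s).
  rewrite /star_sign -exprD; congr (_ ^+ _); rewrite (bigD1 s) //=; congr addn.
  by apply: eq_bigl => t; rewrite !inE andbC.
have e2 : koszul_sign s (~: S) = (-1) ^+ s * koszul_sign s S.
  rewrite /koszul_sign -exprD -signr_odd -[RHS]signr_odd oddD.
  set A := #|_|; set B := #|_|.
  have -> : odd s = odd A (+) odd B.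
    rewrite -oddD; congr odd.
    transitivity (\sum_(t < s) 1)%N; first by rewrite sum1_card card_ord.
    rewrite (big_ord_widen n (fun=> 1%N) (ltnW (ltn_ord s))) (bigID (mem S)) /= addnC.
    by rewrite /A /B -!sum1_card; congr addn; apply: eq_bigl => t; rewrite !inE andbC.
  by rewrite -addbA addbb addbF.
rewrite e1 e2; set x := (-1) ^+ s; have xx : x * x = 1.
  by rewrite /x -expr2 -exprM mulnC exprM sqrrN !expr1n.
have k2 := star_signK (S :\ s).
transitivity ((x * x) * (star_sign (S :\ s) * star_sign (S :\ s)) *
  (koszul_sign s S * g s * u (S :\ s))).
  by rewrite xx k2 !mul1r.
ring.
Qed.

Lemma koszul_delta_exact u : u setT = 0 -> (forall T, koszul_delta u T = 0) ->
  exists v, forall T, u T = koszul_delta v T.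
Proof.
move=> u0 du; have [||v hv] := @koszul_exact (fun T => star_sign (~: T) * u (~: T)).
- by rewrite setC0 u0 mulr0.
- move=> T; have := du (~: T); rewrite koszul_delta_star setCK.
  move=> /(congr1 ( *%R (star_sign (~: T)))).
  by rewrite mulrA star_signK mul1r mulr0.
exists (fun T => star_sign T * v (~: T)) => T; rewrite koszul_delta_star.
rewrite (eq_koszul_d (v := v)) => [|S]; last by rewrite mulrA star_signK mul1r setCK.
by rewrite -hv setCK mulrA star_signK mul1r.
Qed.

Lemma koszul_deltaD u v S :
  koszul_delta (fun T => u T + v T) S = koszul_delta u S + koszul_delta v S.
Proof. by rewrite /koszul_delta -big_split; apply: eq_bigr => s _; rewrite mulrDr. Qed.

Lemma koszul_deltaN u S : koszul_delta (fun T => - u T) S = - koszul_delta u S.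
Proof. by rewrite /koszul_delta -sumrN; apply: eq_bigr => s _; rewrite mulrN. Qed.

Lemma koszul_deltaB u v S :
  koszul_delta (fun T => u T - v T) S = koszul_delta u S - koszul_delta v S.
Proof. by rewrite koszul_deltaD koszul_deltaN. Qed.

Lemma koszul_deltaZ (x : R) u S : koszul_delta (fun T => x * u T) S = x * koszul_delta u S.
Proof. by rewrite /koszul_delta mulr_sumr; apply: eq_bigr => s _; rewrite mulrCA. Qed.

Lemma eq_koszul_delta u v : u =1 v -> koszul_delta u =1 koszul_delta v.
Proof. by move=> h S; apply: eq_bigr => s _; rewrite h. Qed.

Lemma koszul_delta_delta u S : koszul_delta (koszul_delta u) S = 0.
Proof.
rewrite koszul_delta_star
  (eq_koszul_d (v := koszul_d (fun T => star_sign (~: T) * u (~: T)))) => [|T].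
  by rewrite koszul_d_d mulr0.
by rewrite koszul_delta_star mulrA star_signK mul1r setCK.
Qed.

Lemma koszul_delta_set0 u : koszul_delta u set0 = 0.
Proof. by rewrite /koszul_delta big1 // => s; rewrite inE. Qed.

(** No set [S :\ s] is full, so the top component is free to choose. *)
Lemma koszul_delta_drop_setT u S :
  koszul_delta (fun T => if T == setT then 0 else u T) S = koszul_delta u S.
Proof.
apply: eq_bigr => s _; case: eqP => // /setP/(_ s).
by rewrite !inE eqxx.
Qed.

End Koszul.

Section KoszulMatrix.
Variables (k : fieldType) (r n : nat) (g : 'I_n -> {mpoly k[r]}).
Local Notation R := {mpoly k[r]}.
Implicit Types (S T : {set 'I_n}) (u v : {set 'I_n} -> R).

Lemma sum_kosz u T : \sum_S u S * kosz g S T = koszul_d g u T.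
Proof.
rewrite /koszul_d /kosz; under eq_bigr do rewrite mulr_sumr.
rewrite (exchange_big_dep predT) //= [RHS]big_mkcond /=.
apply: eq_bigr => s _; case: ifP => sT.
  rewrite (big_pred1 (s |: T)) => [|S]; last first.
    rewrite /=; apply/andP/eqP => [[sS /eqP <-]|->]; first by rewrite setD1K.
    by rewrite setU11 setU1K.
  by rewrite -/(koszul_sign _ _ _) koszul_signU1_id mulrC.
rewrite big1 // => S /andP[_ /eqP eS].
by move: sT; rewrite -eS setD11.
Qed.

Lemma sum_koszT u S : \sum_T u T * kosz g S T = koszul_delta g u S.
Proof.
rewrite /koszul_delta /kosz; under eq_bigr do rewrite mulr_sumr.
rewrite (exchange_big_dep (mem S)) => [|i s _ /andP[]//] /=.
apply: eq_bigr => s sS.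
rewrite (big_pred1 (S :\ s)) => [|T]; last by rewrite /= sS eq_sym.
by rewrite mulrC.
Qed.

Lemma kosz_card S T : #|S| <> #|T|.+1 -> kosz g S T = 0.
Proof.
move=> h; rewrite /kosz big1 // => s /andP[sS /eqP eT]; case: h.
by rewrite -eT [LHS](cardsD1 s) sS.
Qed.

Lemma sum_kosz_card (P : pred {set 'I_n}) u T :
    (forall S, #|S| = #|T|.+1 -> P S) ->
  \sum_(S | P S) u S * kosz g S T = koszul_d g u T.
Proof.
move=> hP; rewrite -sum_kosz [RHS](bigID P) /= [X in _ + X]big1 ?addr0 // => S nP.
by rewrite kosz_card ?mulr0 // => e; rewrite hP in nP.
Qed.

Lemma sum_koszT_card (P : pred {set 'I_n}) u S :
    (forall T, #|S| = #|T|.+1 -> P T) ->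
  \sum_(T | P T) u T * kosz g S T = koszul_delta g u S.
Proof.
move=> hP; rewrite -sum_koszT [RHS](bigID P) /= [X in _ + X]big1 ?addr0 // => T nP.
by rewrite kosz_card ?mulr0 // => e; rewrite hP in nP.
Qed.

Lemma regular_sequenceP : regular_sequence g -> forall (x : 'I_n) (p : R),
  (exists c, p * g x = \sum_(s : 'I_n | (s < x)%N) c s * g s) ->
  exists c, p = \sum_(s : 'I_n | (s < x)%N) c s * g s.
Proof. by case. Qed.
End KoszulMatrix.

(** * Chain maps and homotopies *)

(** Complexes of finite free modules given by matrices. The basis in degree [i] is the
    part of [X i] cut out by [p i], so that [X i] may be the type of all subsets in every
    degree of a Koszul complex. A row [u] is a cycle when [u d = 0]. *)
Section Complexes.
Variables (R : comNzRingType) (X Y : nat -> finType).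
Variables (p : forall i, pred (X i)) (q : forall i, pred (Y i)).
Variables (c : forall i, X i.+1 -> X i -> R) (d : forall i, Y i.+1 -> Y i -> R).

Definition exact_at i := forall u : Y i.+1 -> R,
  (forall y, q y -> \sum_(y' | q y') u y' * d y' y = 0) ->
  exists v : Y i.+2 -> R,
    forall y', q y' -> u y' = \sum_(y'' | q y'') v y'' * d y'' y'.

Definition is_complex := forall i (x : X i.+2) (y : X i),
  p x -> p y -> \sum_(x' | p x') c x x' * c x' y = 0.

Definition chain_map (G : forall i, X i -> Y i -> R) :=
  forall i (x : X i.+1) (y : Y i), p x -> q y ->
    \sum_(x' | p x') c x x' * G i x' y = \sum_(y' | q y') G i.+1 x y' * d y' y.

Hypothesis cc : is_complex.
Hypothesis ex : forall i, exact_at i.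

(** Choosing preimages by a total function turns the construction of lifts and
    homotopies into plain recursions on the degree. *)
Definition preimage i (w : Y i -> R) : Y i.+1 -> R :=
  epsilon (inhabits (fun=> 0))
    (fun v => forall y, q y -> w y = \sum_(y' | q y') v y' * d y' y).

Lemma preimageP i (w : Y i -> R) :
  (exists v : Y i.+1 -> R, forall y, q y -> w y = \sum_(y' | q y') v y' * d y' y) ->
  forall y, q y -> w y = \sum_(y' | q y') preimage w y' * d y' y.
Proof. exact: epsilon_spec. Qed.

Fixpoint lift (G0 : X 0 -> Y 0 -> R) i : X i -> Y i -> R :=
  match i with
  | 0 => G0
  | j.+1 => fun x => preimage (fun y => \sum_(x' | p x') c x x' * lift G0 x' y)
  end.

(** The comparison theorem, existence: each row [c G] is a cycle because the source is
    a complex, so that exactness of the target provides the next row of [G]. *)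
Lemma chain_map_lift G0 :
  (forall x : X 1, p x -> exists v : Y 1 -> R, forall y, q y ->
     \sum_(x' | p x') c x x' * G0 x' y = \sum_(y' | q y') v y' * d y' y) ->
  exists2 G, chain_map G & G 0 = G0.
Proof.
move=> h0; exists (lift G0) => //; elim=> [|i IH] x y px qy.
  exact: (preimageP (w := fun y => \sum_(x' | p x') c x x' * G0 x' y)) (h0 x px) y qy.
apply: (preimageP (w := fun y => \sum_(x' | p x') c x x' * lift G0 x' y)) => //.
apply: ex => {qy}y qy; under eq_bigr do rewrite mulr_suml.
rewrite exchange_big /=.
rewrite (eq_bigr (fun x' => \sum_(x'' | p x'') c x x' * c x' x'' * lift G0 x'' y)).
  by rewrite exchange_big big1 //= => x'' px''; rewrite -mulr_suml cc ?mul0r.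
move=> x' px'; under eq_bigr do rewrite -mulrA.
by rewrite -mulr_sumr -IH // mulr_sumr; apply: eq_bigr => x'' _; rewrite mulrA.
Qed.

Fixpoint homotopy (Z : forall i, X i -> Y i -> R) i : X i -> Y i.+1 -> R :=
  match i with
  | 0 => fun x => preimage (Z 0 x)
  | j.+1 => fun x => preimage
      (fun y => Z j.+1 x y - \sum_(x' | p x') c x x' * homotopy Z x' y)
  end.

(** The comparison theorem, uniqueness up to homotopy: a chain map which is a boundary
    in degree 0 is null-homotopic. *)
Lemma null_homotopy Z : chain_map Z ->
  (forall x : X 0, p x -> exists v : Y 1 -> R, forall y, q y ->
     Z 0 x y = \sum_(y' | q y') v y' * d y' y) ->
  exists h : forall i, X i -> Y i.+1 -> R,
    (forall (x : X 0) y, p x -> q y -> Z 0 x y = \sum_(y' | q y') h 0 x y' * d y' y) /\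
    (forall i (x : X i.+1) y, p x -> q y -> Z i.+1 x y =
       \sum_(x' | p x') c x x' * h i x' y + \sum_(y' | q y') h i.+1 x y' * d y' y).
Proof.
move=> Zc h0; exists (homotopy Z).
have e0 (x : X 0) y : p x -> q y ->
    Z 0 x y = \sum_(y' | q y') homotopy Z x y' * d y' y.
  by move=> px; apply: preimageP; apply: h0.
split=> // i x y px qy.
suff {y qy} : forall y, q y -> Z i.+1 x y - \sum_(x' | p x') c x x' * homotopy Z x' y
    = \sum_(y' | q y') homotopy Z (x : X i.+1) y' * d y' y.
  by move=> /(_ _ qy) <-; rewrite addrC subrK.
elim: i x px => [|i IH] x px;
  apply: (preimageP (w := fun y => Z _ x y - \sum_(x' | p x') c x x' * homotopy Z x' y));
  apply: ex => y qy; under eq_bigr do rewrite mulrBl; rewrite sumrB -Zc //;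
  apply/eqP; rewrite subr_eq0; apply/eqP.
  under [RHS]eq_bigr do rewrite mulr_suml.
  rewrite exchange_big /=; apply: eq_bigr => x' px'.
  by rewrite e0 // mulr_sumr; apply: eq_bigr => y' _; rewrite mulrA.
under [RHS]eq_bigr do rewrite mulr_suml.
rewrite exchange_big /=.
rewrite [RHS](eq_bigr (fun x' => c x x' * Z i.+1 x' y -
   \sum_(x'' | p x'') c x x' * c x' x'' * homotopy Z x'' y)); last first.
  move=> x' px'; rewrite (eq_bigr (fun y' => c x x' * (homotopy Z x' y' * d y' y))).
    rewrite -mulr_sumr -IH // mulrBr mulr_sumr; congr (_ - _).
    by apply: eq_bigr => ? _; rewrite mulrA.
  by move=> y' _; rewrite mulrA.
rewrite sumrB [X in _ - X]exchange_big [X in _ - X]big1 ?subr0 //= => x'' px''.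
by rewrite -mulr_suml cc ?mul0r.
Qed.

End Complexes.

(** * Koszul complexes as resolutions *)

Section KoszulComplexes.
Variables (k : fieldType) (r n : nat) (g : 'I_n -> {mpoly k[r]}).
Local Notation R := {mpoly k[r]}.
Implicit Types (S T : {set 'I_n}).

Lemma kosz_kosz (P : pred {set 'I_n}) S T :
    (forall S', #|S| = #|S'|.+1 -> P S') ->
  \sum_(S' | P S') kosz g S S' * kosz g S' T = 0.
Proof.
move=> hP; rewrite -[RHS](koszul_d_d g (fun A => (A == S)%:R) T) -sum_kosz.
have e A : kosz g S A = koszul_d g (fun B => (B == S)%:R) A.
  rewrite -sum_kosz (bigD1 S) //= eqxx mul1r big1 ?addr0 // => B /negPf ->.
  by rewrite mul0r.
rewrite [RHS](bigID P) /= [X in _ + X]big1 ?addr0 => [|A nA].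
  by apply: eq_bigr => A _; rewrite -e.
by rewrite -e kosz_card ?mul0r // => h; rewrite hP in nA.
Qed.

Lemma chain_complex : is_complex (fun i S => #|S| == i) (fun i S T => kosz g S T).
Proof. by move=> i S T /eqP hS _; apply: kosz_kosz => S'; rewrite hS => -[<-]. Qed.

Lemma cochain_complex :
  is_complex (fun i S => #|S| + i == n)%N (fun i S T => kosz g T S).
Proof.
move=> i S T hS hT; under eq_bigr do rewrite mulrC.
apply: kosz_kosz => S' e; lia.
Qed.

Hypothesis reg : regular_sequence g.

Lemma chain_exact i : exact_at (fun i S => #|S| == i) (fun i S T => kosz g S T) i.
Proof.
move=> u hu; pose u' S := if #|S| == i.+1 then u S else 0.
have [||v hv] := koszul_exact (regular_sequenceP reg) (u := u').
- by rewrite /u' cards0.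
- move=> T; have [hT|hT] := eqVneq #|T| i; last first.
    rewrite -sum_kosz big1 // => S _; rewrite /u'.
    case: eqP => [hS|_]; last by rewrite mul0r.
    by rewrite kosz_card ?mulr0 // hS => -[e]; rewrite e eqxx in hT.
  rewrite -(@sum_kosz_card _ _ _ _ (fun S => #|S| == i.+1)) => [|S ->]; last by rewrite hT.
  rewrite -[RHS](hu T); last by apply/eqP.
  by apply: eq_bigr => S hS; rewrite /u' hS.
exists v => S hS; have := hv S; rewrite /u' hS => ->.
by symmetry; apply: sum_kosz_card => T ->; rewrite (eqP hS).
Qed.

Lemma cochain_exact i :
  exact_at (fun i S => #|S| + i == n)%N (fun i S T => kosz g T S) i.
Proof.
move=> u hu; pose u' S := if (#|S| + i.+1 == n)%N then u S else 0.
have [||v hv] := koszul_delta_exact (regular_sequenceP reg) (u := u').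
- by rewrite /u' cardsT card_ord; case: eqP => // h; lia.
- move=> T; have [hT|hT] := eqVneq (#|T| + i)%N n; last first.
    rewrite -sum_koszT big1 // => S _; rewrite /u'.
    case: eqP => [hS|_]; last by rewrite mul0r.
    rewrite kosz_card ?mulr0 // => e; case/eqP: hT; lia.
  rewrite -(@sum_koszT_card _ _ _ _ (fun S => #|S| + i.+1 == n)%N) => [|S e]; last lia.
  rewrite -[RHS](hu T); last by apply/eqP.
  by apply: eq_bigr => S hS; rewrite /u' hS.
exists v => S hS; have := hv S; rewrite /u' hS => ->.
by symmetry; apply: sum_koszT_card => T e; lia.
Qed.

Lemma koszul_delta_setT_ideal p : (exists u, p = koszul_delta g u setT) <-> ideal_gen g p.
Proof.
split=> [[u ->]|[a ->]].
  exists (fun s => koszul_sign _ s setT * u (setT :\ s)).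
  by apply: eq_big => [s|s _]; [rewrite inE | rewrite mulrAC].
exists (fun S => \sum_(s | S == setT :\ s) koszul_sign _ s setT * a s).
rewrite /koszul_delta; apply: eq_big => [s|s _]; first by rewrite in_setT.
rewrite (big_pred1 s) => [|t]; last first.
  rewrite /=; apply/eqP/eqP => [/setP/(_ s)|-> //].
  by rewrite !inE eqxx /=; case: eqVneq.
rewrite mulrACA mulrA.
by rewrite {1 2}/koszul_sign -expr2 -exprM mulnC exprM sqrrN !expr1n mul1r mulrC.
Qed.

Lemma koszul_d_set0_ideal p : (exists u, p = koszul_d g u set0) <-> ideal_gen g p.
Proof.
split=> [[u ->]|[a ->]]; first by exists (fun s => u [set s]); exact: koszul_d_set0.
exists (singleton_vector predT a); by rewrite koszul_d_singleton eqxx.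
Qed.
End KoszulComplexes.

(** * The colon ideal of two regular sequences *)

Section Ideals.
Variables (k : fieldType) (r n : nat) (g : 'I_n -> {mpoly k[r]}) (P : pred 'I_n).
Lemma ideal_of0 : ideal_of P g 0.
Proof. by exists (fun=> 0); rewrite big1 // => i _; rewrite mul0r. Qed.
Lemma ideal_ofD p q : ideal_of P g p -> ideal_of P g q -> ideal_of P g (p + q).
Proof.
move=> [a ->] [b ->]; exists (fun i => a i + b i).
by rewrite -big_split; apply: eq_bigr => i _; rewrite mulrDl.
Qed.
Lemma ideal_ofM p q : ideal_of P g q -> ideal_of P g (p * q).
Proof.
move=> [a ->]; exists (fun i => p * a i).
by rewrite mulr_sumr; apply: eq_bigr => i _; rewrite mulrA.
Qed.
Lemma ideal_of_gen i : P i -> ideal_of P g (g i).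
Proof.
move=> Pi; exists (fun j => (j == i)%:R); rewrite (bigD1 i) //= eqxx mul1r.
by rewrite big1 ?addr0 // => j /andP[_ /negPf ->]; rewrite mul0r.
Qed.
Lemma ideal_of_sum (I : finType) (Q : pred I) (F : I -> {mpoly k[r]}) :
  (forall i, Q i -> ideal_of P g (F i)) -> ideal_of P g (\sum_(i | Q i) F i).
Proof. by move=> h; elim/big_ind: _ => //; [exact: ideal_of0|exact: ideal_ofD]. Qed.
End Ideals.

Section Linkage.
Variables (k : fieldType) (r n : nat) (f g : 'I_n -> {mpoly k[r]}).
Local Notation R := {mpoly k[r]}.
Variable phi : {set 'I_n} -> {set 'I_n} -> R.
Implicit Types (S T : {set 'I_n}).
Hypotheses (phi0 : phi set0 set0 = 1)
  (phic : forall S T, #|S| = #|T|.+1 ->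
        \sum_(S' : {set 'I_n} | #|S'| == #|T|) kosz f S S' * phi S' T =
        \sum_(T' : {set 'I_n} | #|T'| == #|S|) phi S T' * kosz g T' T).
Hypotheses (regf : regular_sequence f) (regg : regular_sequence g).
Local Notation Delta := (phi setT setT).

Lemma card_setT S : (#|S| + 0 == n)%N -> S = setT.
Proof.
by rewrite addn0 => /eqP h; apply/eqP; rewrite eqEcard subsetT cardsT card_ord h leqnn.
Qed.

(** The cochain complexes are numbered by codegree, so that they resolve [R/(g)] and
    [R/(f)]; the transpose of [phi] lifts multiplication by [Delta]. *)
Lemma phi_dual_chain_map v : chain_map
  (fun i S => #|S| + i == n)%N (fun i S => #|S| + i == n)%N
  (fun i S T => kosz g T S) (fun i S T => kosz f T S) (fun i T S => v * phi S T).
Proof.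
move=> i T S hT hS.
have e : #|S| = #|T|.+1 by lia.
transitivity (v * \sum_(T' : {set 'I_n} | #|T'| == #|S|) phi S T' * kosz g T' T).
  rewrite mulr_sumr; apply: eq_big => [T'|T' _]; last by rewrite mulrC mulrA.
  apply/eqP/eqP; lia.
rewrite -phic // mulr_sumr; apply: eq_big => [S'|S' _]; last by rewrite mulrCA mulrC.
apply/eqP/eqP; lia.
Qed.

(** Multiplication by [Delta] from [R/(g)] to [R/(f)] is injective. If [v * Delta] lies
    in [(f)] then [v] times the transpose of [phi] lifts the zero map, hence is
    null-homotopic; in the last degree, where [phi] is 1, the homotopy writes [v] as a
    combination of the [g_i]. *)
Lemma colon_Delta_sub v : (0 < n)%N -> ideal_gen f (v * Delta) -> ideal_gen g v.
Proof.
move=> n0 /(koszul_delta_setT_ideal f)[w hw].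
have [T hT|h [_ hh]] := null_homotopy (@cochain_complex _ _ _ g) (cochain_exact regf)
  (phi_dual_chain_map v).
  exists w => S hS; rewrite (card_setT hS) (card_setT hT) hw.
  symmetry; apply: sum_koszT_card => S'.
  rewrite cardsT card_ord; lia.
apply/koszul_d_set0_ideal; have := hh n.-1 set0 set0.
rewrite prednK // cards0 eqxx => /(_ isT isT).
rewrite phi0 mulr1 [X in _ + X]big1 ?addr0 => [->|S hS]; last first.
  by rewrite kosz_card ?mulr0 // cards0.
exists (fun T => h n.-1 T set0).
rewrite -(@sum_kosz_card _ _ _ g (fun S => (#|S| + n.-1 == n)%N)) => [|S].
  by apply: eq_bigr => T _; rewrite mulrC.
rewrite cards0 => ->; lia.
Qed.

(** The homomorphisms from [R/(g)] to [R/(f)] are the multiples of [Delta]. A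
    multiplier [z] lifts to a map [Psi] of cochain complexes; its transpose and
    [u * phi], for a suitable [u], are homotopic, and the homotopy in top degree puts
    [z - u * Delta] in [(f)]. *)
Lemma colon_sub_Delta z : (0 < n)%N -> (forall i, ideal_gen f (z * g i)) ->
  exists u, ideal_gen f (z - u * Delta).
Proof.
move=> n0 hz.
have [T hT|Psi Pc P0] := chain_map_lift (@cochain_complex _ _ _ g) (cochain_exact regf)
  (G0 := fun _ _ => z).
  have [w hw] : exists w, kosz g setT T * z = koszul_delta f w setT.
    apply/koszul_delta_setT_ideal; rewrite mulrC /kosz mulr_sumr; apply: ideal_of_sum => s _.
    by rewrite mulrCA; apply: ideal_ofM; apply: hz.
  exists w => S /card_setT ->; rewrite (big_pred1 setT) => [|T'].
    rewrite hw; symmetry; apply: sum_koszT_card => S'.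
    rewrite cardsT card_ord; lia.
  by rewrite /=; apply/idP/eqP => [/card_setT//|->]; rewrite cardsT card_ord addn0.
(* Transposing Psi gives a chain map between the two Koszul chain complexes; so
   does u * phi, and both induce multiplication by u in degree 0. *)
pose u := Psi n set0 set0; exists u.
pose Z i S T := Psi (n - i)%N T S - u * phi S T.
have Zc : chain_map (fun i S => #|S| == i) (fun i S => #|S| == i)
   (fun i S T => kosz f S T) (fun i S T => kosz g S T) Z.
  move=> i S T /eqP hS /eqP hT.
  have le_n : (#|S| <= n)%N
    by rewrite -[X in (_ <= X)%N]card_ord -cardsT subset_leq_card ?subsetT.
  rewrite /Z (eq_bigr (fun S' => Psi (n - i)%N T S' * kosz f S S'
    - u * (kosz f S S' * phi S' T))).
    have := @phic S T; rewrite hS hT => /(_ erefl) ph.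
    rewrite sumrB -mulr_sumr ph.
    rewrite [RHS](eq_bigr (fun T' => kosz g T' T * Psi (n - i.+1)%N T' S
      - u * (phi S T' * kosz g T' T))).
      rewrite sumrB -mulr_sumr; congr (_ - _).
      have e : (n - i = (n - i.+1).+1)%N by lia.
      rewrite e; have := Pc (n - i.+1)%N T S; rewrite hS hT => h.
      transitivity (\sum_(S' : {set 'I_n} | (#|S'| + (n - i.+1).+1)%N == n)
        Psi (n - i.+1).+1 T S' * kosz f S S').
        by apply: eq_bigl => S'; apply/eqP/eqP; lia.
      rewrite -h; try (apply/eqP; lia).
      by apply: eq_bigl => S'; apply/eqP/eqP; lia.
    by move=> T' _; rewrite mulrBl mulrC mulrA.
  by move=> S' _; rewrite mulrBr mulrC [_ * (u * _)]mulrCA.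
have [S hS|h [_ hh]] := null_homotopy (@chain_complex _ _ _ f) (chain_exact regg) Zc.
  exists (fun=> 0) => T hT; rewrite big1 => [|? _]; last by rewrite mul0r.
  by rewrite /Z subn0 (cards0_eq (eqP hS)) (cards0_eq (eqP hT)) phi0 mulr1 subrr.
have := hh n.-1 setT setT; rewrite prednK // cardsT card_ord eqxx => /(_ isT isT).
rewrite {1}/Z subnn P0 => ->; rewrite [X in _ + X]big1 ?addr0 => [|T hT].
  apply: ideal_of_sum => S _; rewrite mulrC; apply: ideal_ofM.
  by apply: ideal_of_sum => s _; apply: ideal_ofM; apply: ideal_of_gen.
have := subset_leq_card (subsetT T).
by rewrite (eqP hT) cardsT card_ord ltnn.
Qed.
End Linkage.

(** * The dual mapping cone *)

Section Cone.
Variables (k : fieldType) (r n : nat) (f g : 'I_n -> {mpoly k[r]}).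
Local Notation R := {mpoly k[r]}.
Variables (e : nat) (d : 'I_n -> nat) (phi : {set 'I_n} -> {set 'I_n} -> R).
Implicit Types (S T A B : {set 'I_n}) (a b u v w : {set 'I_n} -> R).
Hypotheses (phi0 : phi set0 set0 = 1)
  (phic : forall S T, #|S| = #|T|.+1 ->
        \sum_(S' : {set 'I_n} | #|S'| == #|T|) kosz f S S' * phi S' T =
        \sum_(T' : {set 'I_n} | #|T'| == #|S|) phi S T' * kosz g T' T).
Hypotheses (regf : regular_sequence f) (regg : regular_sequence g).
Hypothesis n_gt0 : (0 < n)%N.
Local Notation Delta := (phi setT setT).
Local Notation I := (ideal_gen g).
Local Notation K := (ideal_gen f).

(** [phi] restricted to pairs of subsets of equal size commutes with the differentials
    on vectors indexed by all subsets. *)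
Definition phi_graded S T : R := if #|S| == #|T| then phi S T else 0.
Definition phi_dual b S : R := \sum_T b T * phi_graded S T.

Lemma phi_gradedC S T :
  \sum_S' phi_graded S' T * kosz f S S' = \sum_T' phi_graded S T' * kosz g T' T.
Proof.
have [h|h] := eqVneq #|S| #|T|.+1; last first.
  rewrite !big1 // => A _; rewrite /phi_graded; case: eqP => [c|_]; rewrite ?mul0r //.
    by rewrite kosz_card ?mulr0 // => c'; case/eqP: h; lia.
  by rewrite kosz_card ?mulr0 // => c'; case/eqP: h; lia.
have := phic h; rewrite [X in X = _]big_mkcond [X in _ = X]big_mkcond /= => ph.
transitivity (\sum_(S' : {set 'I_n}) (if #|S'| == #|T| then kosz f S S' * phi S' T else 0)).
  apply: eq_bigr => A _; rewrite /phi_graded; case: ifP => _; last by rewrite mul0r.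
  by rewrite mulrC.
rewrite ph; apply: eq_bigr => A _; rewrite /phi_graded eq_sym.
by case: ifP => _; last by rewrite mul0r.
Qed.

Lemma koszul_delta_phi_dual b S :
  koszul_delta f (phi_dual b) S = phi_dual (koszul_delta g b) S.
Proof.
rewrite -sum_koszT /phi_dual; under eq_bigr do rewrite mulr_suml.
rewrite exchange_big /=.
transitivity (\sum_T b T * \sum_T' phi_graded S T' * kosz g T' T).
  apply: eq_bigr => T _; rewrite -phi_gradedC mulr_sumr.
  by apply: eq_bigr => A _; rewrite mulrA.
transitivity (\sum_T' (\sum_T b T * kosz g T' T) * phi_graded S T').
  under eq_bigr do rewrite mulr_sumr.
  rewrite exchange_big; apply: eq_bigr => A _; rewrite mulr_suml.
  by apply: eq_bigr => T _; rewrite mulrA mulrAC.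
by apply: eq_bigr => T _; rewrite sum_koszT.
Qed.

Lemma phi_dual_setT b : phi_dual b setT = b setT * Delta.
Proof.
rewrite /phi_dual (bigD1 setT) //= {1}/phi_graded eqxx big1 ?addr0 // => T hT.
rewrite /phi_graded; case: eqP => [c|_]; last by rewrite mulr0.
by case/negP: hT; rewrite eqEcard subsetT c leqnn.
Qed.

Lemma phi_dual_set0 b : phi_dual b set0 = b set0.
Proof.
rewrite /phi_dual (bigD1 set0) //= {1}/phi_graded eqxx phi0 mulr1 big1 ?addr0 // => T hT.
rewrite /phi_graded cards0 eq_sym cards_eq0 (negPf hT) mulr0 //.
Qed.

Lemma phi_dualD a b S : phi_dual (fun T => a T + b T) S = phi_dual a S + phi_dual b S.
Proof. by rewrite /phi_dual -big_split; apply: eq_bigr => T _; rewrite mulrDl. Qed.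

Lemma phi_dualZ (x : R) b S : phi_dual (fun T => x * b T) S = x * phi_dual b S.
Proof. by rewrite /phi_dual mulr_sumr; apply: eq_bigr => T _; rewrite mulrA. Qed.

Lemma eq_phi_dual a b : a =1 b -> phi_dual a =1 phi_dual b.
Proof. by move=> h S; apply: eq_bigr => T _; rewrite h. Qed.

Definition unit0 S : R := (S == set0)%:R.

Lemma phi_dual_unit0 S : phi_dual unit0 S = unit0 S.
Proof.
rewrite /phi_dual (bigD1 set0) //= {1}/unit0 eqxx mul1r big1 ?addr0 => [|T /negPf hT].
  by rewrite /phi_graded cards0 cards_eq0 /unit0; case: eqP => // ->; rewrite phi0.
by rewrite /unit0 hT mul0r.
Qed.

Lemma Delta_colon p : I p -> K (p * Delta).
Proof.
move=> /(koszul_delta_setT_ideal g)[b ->]; rewrite -phi_dual_setT -koszul_delta_phi_dual.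
by apply/koszul_delta_setT_ideal; exists (phi_dual b).
Qed.

(** Linkage: [(f) : (g) = (f) + (Delta)]. *)
Lemma colonP z : colon K I z <-> exists x, K (z - x * Delta).
Proof.
split=> [hz|[x hx] q Iq].
  by apply: (@colon_sub_Delta _ _ _ f g phi) => // i; apply: hz; apply: ideal_of_gen.
rewrite -[z](subrK (x * Delta)) mulrDl; apply: ideal_ofD.
  by rewrite mulrC; apply: ideal_ofM.
by rewrite -mulrA [Delta * q]mulrC; apply/ideal_ofM/Delta_colon.
Qed.

(** Exactness of the cone, for vectors [(a, b)] indexed by all subsets and vanishing at
    the two cancelled basis elements; [a setT = 0] excludes homological degree 0. The
    cone of the transpose of [phi] is exact because both cochain complexes are exact
    below the top degree and multiplication by [Delta] is injective there. *)
Lemma cone_exact_total a b : a set0 = 0 -> b set0 = 0 -> a setT = 0 ->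
    (forall S, koszul_delta f a S + phi_dual b S = 0) -> (forall S, koszul_delta g b S = 0) ->
  exists a' b', [/\ a' set0 = 0, b' set0 = 0,
    forall S, a S = koszul_delta f a' S + phi_dual b' S
    & forall S, b S = - koszul_delta g b' S].
Proof.
move=> a0 b0 aT hab hb.
(* At setT the cycle equation says Delta * b(setT) lies in (f), hence b(setT)
   lies in (g) and can be removed from b by a coboundary. *)
have [w hw] : exists w, b setT = koszul_delta g w setT.
  apply/koszul_delta_setT_ideal; apply: (@colon_Delta_sub _ _ _ f g phi) => //.
  have /eqP := hab setT; rewrite phi_dual_setT addrC addr_eq0 => /eqP ->.
  rewrite -mulN1r; apply: ideal_ofM; apply/koszul_delta_setT_ideal; by exists a.
have [||w' hw'] := koszul_delta_exact (regular_sequenceP regg)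
    (u := fun S => b S - koszul_delta g w S).
- by rewrite hw subrr.
- by move=> T; rewrite koszul_deltaB hb koszul_delta_delta subrr.
pose b1 S := if S == setT then 0 else - (w S + w' S).
have hb1 S : b S = - koszul_delta g b1 S.
  rewrite /b1 koszul_delta_drop_setT koszul_deltaN opprK koszul_deltaD -hw' addrC subrK //.
have [||a1 ha1] := koszul_delta_exact (regular_sequenceP regf)
    (u := fun S => a S - phi_dual b1 S).
- by rewrite aT phi_dual_setT /b1 eqxx mul0r subrr.
- move=> T; rewrite koszul_deltaB koszul_delta_phi_dual -[RHS](hab T); congr (_ + _).
  rewrite -mulN1r -phi_dualZ; apply: eq_phi_dual => S; by rewrite hb1 mulN1r.
(* phi set0 set0 = 1 makes the component at set0 of a boundary equal to b1(set0). *)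
have b10 : b1 set0 = 0.
  rewrite -phi_dual_set0; have /eqP := ha1 set0.
  by rewrite koszul_delta_set0 a0 sub0r oppr_eq0 => /eqP.
(* Subtracting x times the boundary of the cancelled basis element clears a1(set0)
   and leaves the boundary of (a1, b1) unchanged. *)
pose x := a1 set0.
exists (fun S => a1 S - x * unit0 S), (fun S => b1 S + x * koszul_delta g unit0 S); split.
- by rewrite /unit0 eqxx mulr1 subrr.
- by rewrite b10 koszul_delta_set0 mulr0 addr0.
- move=> S; rewrite koszul_deltaB -ha1 koszul_deltaZ.
  rewrite phi_dualD phi_dualZ -koszul_delta_phi_dual.
  by rewrite (eq_koszul_delta f phi_dual_unit0) [X in _ = _ - _ + X]addrC addrA !subrK.
- by move=> S; rewrite koszul_deltaD koszul_deltaZ koszul_delta_delta mulr0 addr0.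
Qed.

Definition extend0 (P : pred {set 'I_n}) (u : {S | P S} -> R) S : R :=
  oapp u 0 (insub S).

Lemma extend0_val (P : pred {set 'I_n}) (u : {S | P S} -> R) s : extend0 u (val s) = u s.
Proof. by rewrite /extend0 valK. Qed.

Lemma extend0_out (P : pred {set 'I_n}) (u : {S | P S} -> R) S : ~~ P S -> extend0 u S = 0.
Proof. by move=> h; rewrite /extend0 insubN. Qed.

Lemma sum_extend0 (P : pred {set 'I_n}) (u : {S | P S} -> R) (F : {set 'I_n} -> R) :
  \sum_(s : {S | P S}) u s * F (val s) = \sum_S extend0 u S * F S.
Proof.
rewrite [RHS](bigID P) /= [X in _ + X]big1 ?addr0 => [|S hS]; last first.
  by rewrite extend0_out ?mul0r.
rewrite [RHS]big_sub /=.
by apply: eq_bigr => s _; rewrite extend0_val.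
Qed.

Local Notation P := (dual_mapping_cone f g e d phi).

Definition cone_left i (u : {ffun cone_basis n i -> R}) S : R :=
  extend0 (fun s => u (inl s)) S.
Definition cone_right i (u : {ffun cone_basis n i -> R}) S : R :=
  extend0 (fun s => u (inr s)) S.

Lemma cone_gmap_left i (u : {ffun cone_basis n i.+1 -> R})
    (s : {S : {set 'I_n} | (#|S| + i == n)%N && (S != set0)}) :
  gmap (F := P) u (inl s) =
    koszul_delta f (cone_left u) (val s) + phi_dual (cone_right u) (val s).
Proof.
rewrite ffunE big_sumType /= -sum_koszT; congr (_ + _).
  exact: (sum_extend0 (fun s => u (inl s)) (fun S => kosz f (val s) S)).
rewrite (sum_extend0 (fun s => u (inr s)) (fun S => phi (val s) S)).
apply: eq_bigr => T _; rewrite /phi_graded; case: eqP => // h.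
rewrite /cone_right extend0_out ?mul0r //; apply/negP => /andP[/eqP hT _].
case: s h => S /= /andP[/eqP hS _] h; apply: h.
by apply: (@addIn i); apply: (etrans hS); apply: succn_inj; rewrite -addnS; exact: esym hT.
Qed.

Lemma cone_gmap_right i (u : {ffun cone_basis n i.+1 -> R})
    (s : {S : {set 'I_n} | (#|S| + i == n.+1)%N && (S != set0)}) :
  gmap (F := P) u (inr s) = - koszul_delta g (cone_right u) (val s).
Proof.
rewrite ffunE big_sumType /= -sum_koszT big1 ?add0r => [|? _]; last by rewrite mulr0.
under eq_bigr do rewrite mulrN; rewrite sumrN; congr (- _).
exact: (sum_extend0 (fun s => u (inr s)) (fun S => kosz g (val s) S)).
Qed.

(** The differential of the cone in terms of vectors indexed by all subsets: the sums
    outside the basis in the given degree vanish, as do the components at [set0]. *)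
Lemma cone_left_gmap i (u : {ffun cone_basis n i.+1 -> R}) S :
  cone_left (gmap (F := P) u) S = koszul_delta f (cone_left u) S + phi_dual (cone_right u) S.
Proof.
have [h|h] := boolP ((#|S| + i == n)%N && (S != set0)).
  have /= <- := cone_gmap_left u (Sub S h).
  exact: (extend0_val (fun s => gmap (F := P) u (inl s)) (Sub S h)).
rewrite [LHS]extend0_out //; have [->|S0] := eqVneq S set0.
  by rewrite koszul_delta_set0 phi_dual_set0 add0r [RHS]extend0_out // eqxx andbF.
rewrite S0 andbT in h; rewrite -sum_koszT /phi_dual !big1 ?addr0 // => T _.
  rewrite /phi_graded; case: eqP => e1; rewrite ?mulr0 //.
  rewrite [X in X * _]extend0_out ?mul0r //; lia.
have [hT|hT] := boolP ((#|T| + i.+1 == n)%N && (T != set0)); last first.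
  by rewrite [X in X * _]extend0_out ?mul0r.
rewrite kosz_card ?mulr0 // => e1; lia.
Qed.

Lemma cone_right_gmap i (u : {ffun cone_basis n i.+1 -> R}) S :
  cone_right (gmap (F := P) u) S = - koszul_delta g (cone_right u) S.
Proof.
have [h|h] := boolP ((#|S| + i == n.+1)%N && (S != set0)).
  have /= <- := cone_gmap_right u (Sub S h).
  exact: (extend0_val (fun s => gmap (F := P) u (inr s)) (Sub S h)).
rewrite [LHS]extend0_out //; have [->|S0] := eqVneq S set0.
  by rewrite koszul_delta_set0 oppr0.
rewrite S0 andbT in h; rewrite -sum_koszT big1 ?oppr0 // => T _.
have [hT|hT] := boolP ((#|T| + i.+1 == n.+1)%N && (T != set0)); last first.
  by rewrite [X in X * _]extend0_out ?mul0r.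
rewrite kosz_card ?mulr0 // => e1; lia.
Qed.

Lemma cone_gmap_gmap i (u : {ffun cone_basis n i.+2 -> R}) :
  gmap (F := P) (gmap (F := P) u) = 0.
Proof.
apply/ffunP => -[s|s]; rewrite [RHS]ffunE ?cone_gmap_left ?cone_gmap_right.
  rewrite (eq_koszul_delta _ (cone_left_gmap u)) (eq_phi_dual (cone_right_gmap u)).
  rewrite koszul_deltaD koszul_delta_delta add0r koszul_delta_phi_dual.
  rewrite -phi_dualD /phi_dual big1 // => T _.
  by rewrite addrN mul0r.
by rewrite (eq_koszul_delta _ (cone_right_gmap u)) koszul_deltaN koszul_delta_delta !oppr0.
Qed.

Lemma koszul_delta_restrict (h : 'I_n -> R) (Q : pred {set 'I_n}) a a' S :
    (forall T, Q T -> a T = a' T) -> (forall T, ~~ Q T -> a' T = 0) ->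
    (forall T, ~~ Q T -> a T != 0 -> #|S| <> #|T|.+1) ->
  koszul_delta h a S = koszul_delta h a' S.
Proof.
move=> h1 h2 h3; rewrite -!sum_koszT; apply: eq_bigr => T _.
have [QT|QT] := boolP (Q T); first by rewrite h1.
rewrite (h2 T) //; have [->//|aT] := eqVneq (a T) 0.
by rewrite kosz_card ?mulr0 ?mul0r //; apply: h3.
Qed.

Lemma cone_exact i (u : {ffun gbasis P i.+1 -> R}) :
  gmap u = 0 <-> exists x, u = gmap x.
Proof.
split=> [hu|[v ->]]; last exact: cone_gmap_gmap.
have left0 S : cone_left (0 : {ffun cone_basis n i -> R}) S = 0.
  by rewrite /cone_left /extend0; case: insub => //= s; rewrite ffunE.
have right0 S : cone_right (0 : {ffun cone_basis n i -> R}) S = 0.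
  by rewrite /cone_right /extend0; case: insub => //= s; rewrite ffunE.
have [|||||a' [b' [a0 b0 ha hb]]] := @cone_exact_total (cone_left u) (cone_right u).
- by rewrite [LHS]extend0_out // eqxx andbF.
- by rewrite [LHS]extend0_out // eqxx andbF.
- rewrite [LHS]extend0_out // cardsT card_ord; lia.
- by move=> S; rewrite -cone_left_gmap hu.
- by move=> S; apply: oppr_inj; rewrite -cone_right_gmap hu oppr0.
pose v : {ffun cone_basis n i.+2 -> R} :=
  [ffun x => match x with inl s => a' (val s) | inr s => b' (val s) end].
have vl T : (#|T| + i.+2 == n)%N && (T != set0) -> a' T = cone_left v T.
  by move=> h; rewrite /cone_left /extend0 insubT /= ffunE.
have vr T : (#|T| + i.+2 == n.+1)%N && (T != set0) -> b' T = cone_right v T.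
  by move=> h; rewrite /cone_right /extend0 insubT /= ffunE.
exists v; apply/ffunP => -[s|s]; rewrite ?cone_gmap_left ?cone_gmap_right.
  transitivity (cone_left u (val s)); first by rewrite /cone_left extend0_val.
  case: s => S hS /=; rewrite ha; congr (_ + _).
    apply: (koszul_delta_restrict f vl) => T hT; first by rewrite [LHS]extend0_out.
    move=> aT e1; have T0 : T != set0 by apply: contraNneq aT => ->; rewrite a0.
    by move: hT; rewrite T0 andbT; case/andP: hS; lia.
  apply: eq_bigr => T _.
  have [hT|hT] := boolP ((#|T| + i.+2 == n.+1)%N && (T != set0)).
    by rewrite vr.
  rewrite [X in _ = X * _]extend0_out // mul0r.
  have [->|T0] := eqVneq T set0; first by rewrite b0 mul0r.
  rewrite T0 andbT in hT; rewrite /phi_graded; case: eqP => e1; rewrite ?mulr0 //.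
  by case/andP: hS; lia.
transitivity (cone_right u (val s)); first by rewrite /cone_right extend0_val.
case: s => S hS /=; rewrite hb; congr (- _).
apply: (koszul_delta_restrict g vr) => T hT; first by rewrite [LHS]extend0_out.
move=> aT e1; have T0 : T != set0 by apply: contraNneq aT => ->; rewrite b0.
by move: hT; rewrite T0 andbT; case/andP: hS; lia.
Qed.

Hypothesis n_gt1 : (1 < n)%N.

Lemma setT_neq0 : [set: 'I_n] != set0.
Proof. by rewrite -card_gt0 cardsT card_ord. Qed.

Lemma cone0_inr (B : {S : {set 'I_n} | (#|S| + 0 == n.+1)%N && (S != set0)}) : False.
Proof.
case: B => B /andP[/eqP hB _]; have := subset_leq_card (subsetT B).
by rewrite cardsT card_ord -ltnS -hB addn0 ltnn.
Qed.

Lemma cone_aug (u : {ffun cone_basis n 0 -> R}) : \sum_b u b * 1 = cone_left u setT.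
Proof.
rewrite big_sumType /= [X in _ + X]big1 ?addr0 => [|B]; last by case: (cone0_inr B).
rewrite (sum_extend0 (fun s => u (inl s)) (fun=> 1)) (bigD1 setT) //= mulr1.
rewrite big1 ?addr0 // => S hS; rewrite extend0_out ?mul0r //.
by apply: contra hS => /andP[/card_setT -> _].
Qed.

(** In degree 0 the only basis element is [setT], and the image of the differential
    there is [(f) + (Delta)], the colon ideal. *)
Lemma cone_resolves : resolves P (colon K I).
Proof.
have hT0 : (#|[set: 'I_n]| + 0 == n)%N && ([set: 'I_n] != set0).
  by rewrite cardsT card_ord addn0 eqxx setT_neq0.
exists (fun=> 1); split.
- move=> [s|s] /=; first by rewrite mul0n; exact: dhomog1.
  by case: (cone0_inr s).
- move=> p; exists [ffun=> p]; rewrite cone_aug.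
  rewrite /cone_left (extend0_val (fun s => [ffun=> p] (inl s)) (Sub setT hT0)) ffunE subrr.
  by apply/colonP; exists 0; rewrite mul0r subr0; exact: ideal_of0.
- move=> u; rewrite cone_aug; split=> [/colonP[x]|[v ->]]; last first.
    rewrite cone_left_gmap phi_dual_setT; apply/colonP; exists (cone_right v setT).
    by rewrite addrK; apply/koszul_delta_setT_ideal; exists (cone_left v).
  move=> /(koszul_delta_setT_ideal f)[w hw].
  pose v : {ffun cone_basis n 1 -> R} :=
    [ffun y => match y with inl s => w (val s) | inr s => x end].
  exists v; apply/ffunP => -[s|s]; last by case: (cone0_inr s).
  rewrite cone_gmap_left.
  have es : s = Sub setT hT0.
    by apply: val_inj; case: s => S /= /andP[/card_setT].
  transitivity (cone_left u (val s)); first by rewrite /cone_left extend0_val.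
  have -> : val s = setT by rewrite es.
  rewrite phi_dual_setT; have -> : cone_right v setT = x.
    have hT1 : (#|[set: 'I_n]| + 1 == n.+1)%N && ([set: 'I_n] != set0).
      by rewrite cardsT card_ord addn1 eqxx setT_neq0.
    by rewrite /cone_right (extend0_val (fun s => v (inr s)) (Sub setT hT1)) ffunE.
  rewrite -[LHS](subrK (x * Delta)) hw; congr (_ + _).
  apply: eq_bigr => t _; congr (_ * _).
  have ct : (#|[set: 'I_n] :\ t| + 1 = n)%N.
    by have := cardsD1 t setT; rewrite in_setT cardsT card_ord addnC => <-.
  have ht : (#|[set: 'I_n] :\ t| + 1 == n)%N && ([set: 'I_n] :\ t != set0).
    rewrite ct eqxx -card_gt0; lia.
  by rewrite /cone_left (extend0_val (fun s => v (inl s)) (Sub ([set: 'I_n] :\ t) ht)) ffunE.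
- exact: cone_exact.
Qed.

End Cone.

(** * Homogeneous components and homogeneous ideals *)

Section HomogPart.
Variables (k : fieldType) (r : nat).
Local Notation R := {mpoly k[r]}.
Implicit Types (a b c : int) (p q : R) (J : R -> Prop).

(** The homogeneous component of integer degree [a]; it is 0 in negative degree, like
    the elements that [homogz] admits there. *)
Definition hpart a p : R := if a is Posz m then pihomog mdeg m p else 0.

Lemma homogz0 a : homogz a (0 : R).
Proof. by case: a => //= m; apply: dhomog0. Qed.
Lemma homogzD a p q : homogz a p -> homogz a q -> homogz a (p + q).
Proof. by case: a => [m|m] /=; [apply: dhomogD | move=> -> ->; rewrite addr0]. Qed.
Lemma homogzN a p : homogz a p -> homogz a (- p).
Proof. by case: a => [m|m] /=; [rewrite dhomogN | move=> ->; rewrite oppr0]. Qed.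

Lemma hpart_homogz a p : homogz a (hpart a p).
Proof. by case: a => //= m; apply: pihomogP. Qed.

Lemma hpart_is_additive a : zmod_morphism (hpart a).
Proof. by case: a => m p q /=; rewrite ?subr0 // raddfB. Qed.
HB.instance Definition _ a := GRing.isZmodMorphism.Build R R (hpart a) (hpart_is_additive a).

Lemma hpart_homog m c p : p \is m.-homog -> hpart c p = if c == m then p else 0.
Proof.
move=> hp; case: c => [j|j] //=; rewrite eqz_nat.
by case: eqVneq => [->|jm]; [exact: pihomog_dE | rewrite (pihomog_ne0 _ hp) // eq_sym].
Qed.

Lemma hpart_id a p : homogz a p -> hpart a p = p.
Proof. by case: a => [m|m] /=; [exact: pihomog_dE | move->]. Qed.

Lemma hpartM a c p q : homogz a q -> hpart c (q * p) = q * hpart (c - a) p.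
Proof.
case: a => [m|m] /=; last by move=> ->; rewrite !mul0r raddf0.
move=> hq; rewrite [p](pihomog_partitionE (mf := mdeg) (k := mmeasure mdeg p)) //.
rewrite mulr_sumr !raddf_sum /= mulr_sumr; apply: eq_bigr => j _.
rewrite (hpart_homog _ (pihomogP mdeg j p)).
rewrite (hpart_homog c (dhomogM hq (pihomogP mdeg j p))) PoszD.
by rewrite subr_eq addrC; case: ifP => _; rewrite ?mulr0.
Qed.

Lemma homogz_const a p : homogz a p -> p@_0%MM != 0 -> a = 0.
Proof.
case: a => [m|m] /=; last by move=> ->; rewrite mcoeff0 eqxx.
move=> hp; apply: contra_neq_eq => m0.
apply: (dhomog_nemf_coeff hp); apply: contra_neq m0 => <-.
by rewrite /= mdeg0.
Qed.
Record homog_ideal J : Prop := HomogIdeal {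
  homog_ideal0 : J 0;
  homog_idealD : forall p q, J p -> J q -> J (p + q);
  homog_idealM : forall p q, J q -> J (p * q);
  homog_ideal_hpart : forall (c : int) p, J p -> J (hpart c p) }.

Lemma homog_idealB J p q : homog_ideal J -> J p -> J q -> J (p - q).
Proof.
move=> hJ hp hq; apply: (homog_idealD hJ) => //.
by rewrite -mulN1r; apply: (homog_idealM hJ).
Qed.

Lemma homog_ideal_sum J (T : finType) (F : T -> R) :
  homog_ideal J -> (forall i, J (F i)) -> J (\sum_i F i).
Proof.
by move=> hJ h; apply: (big_ind J) => // [|p q]; [exact: homog_ideal0|exact: homog_idealD].
Qed.
End HomogPart.

Lemma homogz_kosz (k : fieldType) (r n : nat) (h : 'I_n -> {mpoly k[r]})
    (m : 'I_n -> nat) (S T : {set 'I_n}) :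
  (forall i, h i \is (m i).-homog) ->
  homogz ((\sum_(t in S) m t)%N%:Z - (\sum_(t in T) m t)%N%:Z) (kosz h S T).
Proof.
move=> hh; apply: (big_ind (homogz _)) => [|p q|s /andP[sS /eqP <-]].
- exact: homogz0.
- exact: homogzD.
rewrite (bigD1 s) //= [X in (_ + X)%N](eq_bigl (mem (S :\ s))) /=; last first.
  by move=> t; rewrite !inE andbC.
rewrite PoszD addrK /= rpredMsign; exact: hh.
Qed.

Section ConeGraded.
Variables (k : fieldType) (r n : nat) (f g : 'I_n -> {mpoly k[r]}).
Variables (e : nat) (d : 'I_n -> nat) (phi : {set 'I_n} -> {set 'I_n} -> {mpoly k[r]}).
Hypotheses (homf : forall i, f i \is e.-homog) (homg : forall i, g i \is (d i).-homog).
Hypothesis phih : forall S T : {set 'I_n}, #|S| = #|T| ->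
  homogz ((#|S| * e)%N%:Z - (\sum_(t in T) d t)%N%:Z) (phi S T).

Lemma cone_graded : graded (dual_mapping_cone f g e d phi).
Proof.
move=> i [A|B] [A'|B'] /=.
- have := homogz_kosz (h := f) (m := fun=> e) (val A') (val A) homf.
  rewrite !sum_nat_const.
  case/andP: (valP A) => /eqP hA _; case/andP: (valP A') => /eqP hA' _.
  suff -> : (#|val A'| * e)%N%:Z - (#|val A| * e)%N%:Z = (i.+1 * e)%N%:Z - (i * e)%N%:Z by [].
  move: hA hA'; move: #|_| #|_| => x y <- e'; have -> : x = y.+1 by lia.
  rewrite !mulSn !PoszD; lia.
- exact: homogz0.
- case/andP: (valP B) => /eqP hB _; case/andP: (valP A') => /eqP hA' _.
  have hc : #|val A'| = #|val B|.
    by apply: (@addIn i); apply: (etrans hA');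
       apply: succn_inj; rewrite -addnS; exact: esym hB.
  have := phih hc.
  suff -> : (n * e)%N%:Z - (\sum_(t in val B) d t)%N%:Z - (i * e)%N%:Z =
    (#|val A'| * e)%N%:Z - (\sum_(t in val B) d t)%N%:Z by [].
  have -> : (n * e)%N%:Z = (#|val A'| * e)%N%:Z + (i * e)%N%:Z.
    by rewrite -PoszD -mulnDl hA'.
  by rewrite addrAC addrK.
- have := homogz_kosz (val B') (val B) homg.
  set x := Posz _; set y := Posz _ => h.
  have -> : (n * e)%N%:Z - y - ((n * e)%N%:Z - x) = x - y by ring.
  exact: homogzN.
Qed.
End ConeGraded.

(** * Shifts of minimal resolutions *)

Section Shifts.
Variables (k : fieldType) (r : nat) (J : {mpoly k[r]} -> Prop).
Local Notation R := {mpoly k[r]}.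
Hypothesis hJ : homog_ideal J.

(** [resolves] with the augmentation as a parameter: comparing two resolutions involves
    both augmentations. *)
Definition resolves_via (F : gfree k r) (aug : gbasis F 0 -> R) :=
  [/\ forall b, homogz (gshift b) (aug b),
        forall p : R, exists u : {ffun gbasis F 0 -> R},
          J (p - \sum_b u b * aug b),
        forall u : {ffun gbasis F 0 -> R},
          J (\sum_b u b * aug b) <-> exists v, u = gmap v
      & forall i (u : {ffun gbasis F i.+1 -> R}),
          gmap u = 0 <-> exists v, u = gmap v].

Local Notation all := (fun _ _ => true).

Lemma resolves_via_exact F aug : @resolves_via F aug ->
  forall i, exact_at all (@gdiff _ _ F) i.
Proof.
case=> _ _ _ ex i u hu; have [|v hv] := (ex i [ffun y => u y]).1.
  apply/ffunP => y; rewrite !ffunE -[RHS](hu y) //.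
  by apply: eq_bigr => b _; rewrite ffunE.
exists v => y _; have /ffunP/(_ y) := hv; rewrite !ffunE => ->.
by [].
Qed.

Lemma resolves_via_complex F aug : @resolves_via F aug -> is_complex all (@gdiff _ _ F).
Proof.
case=> _ _ _ ex i x y _ _.
have : gmap (gmap [ffun b : gbasis F i.+2 => (b == x)%:R : R]) = 0 by apply/ex; eexists.
move=> /ffunP/(_ y); rewrite !ffunE => e; rewrite -[RHS]e.
apply: eq_bigr => x' _; congr (_ * _).
rewrite ffunE (bigD1 x) //= ffunE eqxx mul1r big1 ?addr0 // => b /negPf h.
by rewrite ffunE h mul0r.
Qed.

Lemma resolves_via0 F aug : @resolves_via F aug -> forall w : gbasis F 0 -> R,
  J (\sum_y w y * aug y) -> exists v : gbasis F 1 -> R,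
    forall y, w y = \sum_y' v y' * gdiff y' y.
Proof.
case=> _ _ ex0 _ w hw; have [|v hv] := (ex0 [ffun y => w y]).1.
  by under eq_bigr do rewrite ffunE.
by exists v => y; have /ffunP/(_ y) := hv; rewrite !ffunE.
Qed.

Lemma resolves_via_gdiff F aug : @resolves_via F aug -> forall x : gbasis F 1,
  J (\sum_y gdiff x y * aug y).
Proof.
case=> _ _ ex0 _ x.
have /ex0 : exists v, gmap [ffun b => (b == x)%:R : R] = gmap v by eexists.
congr J; apply: eq_bigr => y _; congr (_ * _).
rewrite ffunE (bigD1 x) //= ffunE eqxx mul1r big1 ?addr0 // => b /negPf h.
by rewrite ffunE h mul0r.
Qed.

(** Any lift of the identity of [R/J] can be made homogeneous by keeping, in each
    entry, only the component of the right degree: the differentials being homogeneous,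
    the chain map equation splits into components. *)
Lemma graded_lift P F augP augF : graded P -> graded F ->
    @resolves_via P augP -> @resolves_via F augF ->
  exists G : forall i, gbasis P i -> gbasis F i -> R,
  [/\ chain_map all all (@gdiff _ _ P) (@gdiff _ _ F) G,
    forall i x y, homogz (gshift x - gshift y) (G i x y)
    & forall x, J (augP x - \sum_y G 0 x y * augF y)].
Proof.
move=> gP gF aP aF.
have [g0 hg0] : exists g0 : gbasis P 0 -> {ffun gbasis F 0 -> R},
    forall x, J (augP x - \sum_y g0 x y * augF y).
  have [_ h _ _] := aF.
  pose c x := constructive_indefinite_description _ (h (augP x)).
  exists (fun x => proj1_sig (c x)) => x; exact: (proj2_sig (c x)).
have [x _|G Gc G0] := chain_map_lift (resolves_via_complex aP) (resolves_via_exact aF)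
    (G0 := fun x => g0 x).
  have [|v hv] := resolves_via0 aF (w := fun y => \sum_x' gdiff x x' * g0 x' y);
    last by exists v => y _; exact: hv.
  have -> : \sum_y (\sum_x' gdiff x x' * g0 x' y) * augF y =
    \sum_x' gdiff x x' * augP x' -
    \sum_x' gdiff x x' * (augP x' - \sum_y g0 x' y * augF y).
    rewrite -sumrB; under eq_bigr do rewrite mulr_suml.
    rewrite exchange_big; apply: eq_bigr => x' _ /=.
    rewrite -mulrBr opprB addrC subrK mulr_sumr.
    by apply: eq_bigr => y _; rewrite mulrA.
  apply: (homog_idealB hJ); first exact: (resolves_via_gdiff aP).
  by apply: (homog_ideal_sum hJ) => x'; apply: (homog_idealM hJ).
exists (fun i x y => hpart (gshift x - gshift y) (G i x y)); split.
- move=> i x y _ _.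
  have := congr1 (hpart (gshift x - gshift y)) (Gc i x y isT isT).
  rewrite !raddf_sum /= => h.
  transitivity (\sum_x' hpart (gshift x - gshift y) (gdiff x x' * G i x' y)).
    apply: eq_bigr => x' _; rewrite (hpartM _ _ (gP i x x')); congr (_ * hpart _ _).
    by ring.
  rewrite h; apply: eq_bigr => y' _.
  rewrite mulrC (hpartM _ _ (gF i y' y)) mulrC; congr (hpart _ _ * _).
  by ring.
- by move=> i x y; exact: hpart_homogz.
- move=> x; rewrite G0.
  have [hP _ _ _] := aP; have [hF _ _ _] := aF.
  have := homog_ideal_hpart hJ (gshift x) (hg0 x).
  rewrite raddfB raddf_sum /= (hpart_id (hP x)).
  congr (J (_ - _)); apply: eq_bigr => y _.
  by rewrite mulrC (hpartM _ _ (hF y)) mulrC.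
Qed.

(** Uniqueness of the shifts of a minimal resolution, one inclusion. If [G : P -> F] and
    [H : F -> P] lift the identity, then [G H - 1 = c h + h d], whose entries have no
    constant term by minimality of [P]. The diagonal entries of [G H] therefore have
    constant term 1, and a homogeneous entry of [G] with a constant term joins basis
    elements of equal shift. *)
Lemma shift_transfer P F : graded P -> graded F -> minimal P ->
    resolves P J -> resolves F J ->
  forall i (x : gbasis P i), exists y : gbasis F i, gshift y = gshift x.
Proof.
move=> gP gF mP [augP aP] [augF aF] i x.
have [G [Gc Gh G0]] := graded_lift gP gF aP aF.
have [H [Hc Hh H0]] := graded_lift gF gP aF aP.
(* Z lifts the zero map of R/J, hence is null-homotopic. *)
pose Z i (x x' : gbasis P i) : R := \sum_y G i x y * H i y x' - (x == x')%:R.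
have Zc : chain_map all all (@gdiff _ _ P) (@gdiff _ _ P) Z.
  move=> j z z' _ _; rewrite /Z.
  transitivity (\sum_y \sum_x' gdiff z x' * G j x' y * H j y z' - gdiff z z').
    under eq_bigr do rewrite mulrBr mulr_sumr.
    rewrite sumrB exchange_big /=; congr (_ - _).
      by apply: eq_bigr => y _; apply: eq_bigr => ? _; rewrite mulrA.
    rewrite (bigD1 z') //= eqxx mulr1 big1 ?addr0 // => t /negPf ->.
    by rewrite mulr0.
  under [RHS]eq_bigr do rewrite mulrBl mulr_suml.
  rewrite sumrB [X in _ = X - _]exchange_big /=; congr (_ - _); last first.
    rewrite (bigD1 z) //= eqxx mul1r big1 ?addr0 // => t.
    by rewrite eq_sym => /negPf ->; rewrite mul0r.
  transitivity (\sum_y (\sum_y' G j.+1 z y' * gdiff y' y) * H j y z').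
    apply: eq_bigr => y _; rewrite -mulr_suml; congr (_ * _).
    exact: (Gc j z y isT isT).
  transitivity (\sum_y \sum_y' G j.+1 z y' * gdiff y' y * H j y z').
    by apply: eq_bigr => y _; rewrite mulr_suml.
  rewrite exchange_big; apply: eq_bigr => y' _ /=.
  transitivity (G j.+1 z y' * \sum_t gdiff y' t * H j t z').
    by rewrite mulr_sumr; apply: eq_bigr => t _; rewrite mulrA.
  rewrite (Hc j y' z' isT isT) mulr_sumr.
  by apply: eq_bigr => t _; rewrite mulrA.
have [z _|h [h0 hS]] := null_homotopy (resolves_via_complex aP) (resolves_via_exact aP) Zc.
  have [|v hv] := resolves_via0 aP (w := fun y => Z 0 z y);
    last by exists v => y _; exact: hv.
  have -> : \sum_y Z 0 z y * augP y =
    \sum_y G 0 z y * augF y - augP z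
    - \sum_y G 0 z y * (augF y - \sum_x' H 0 y x' * augP x').
    rewrite /Z; under eq_bigr do rewrite mulrBl mulr_suml.
    rewrite sumrB exchange_big /=.
    rewrite [X in _ - X](bigD1 z) //= eqxx mul1r [X in _ - (_ + X)]big1 ?addr0; last first.
      by move=> t; rewrite eq_sym => /negPf ->; rewrite mul0r.
    rewrite addrAC -sumrB; congr (_ - _); apply: eq_bigr => y _.
    rewrite -mulrBr opprB addrC subrK mulr_sumr.
    by apply: eq_bigr => t _; rewrite mulrA.
  apply: (homog_idealB hJ).
    by rewrite -opprB -mulN1r; apply: (homog_idealM hJ).
  by apply: (homog_ideal_sum hJ) => y; apply: (homog_idealM hJ).
have Z0 : (Z i x x)@_0%MM = 0.
  have const0 j (w : gbasis P j.+1 -> R) y : (\sum_y' w y' * gdiff y' y)@_0%MM = 0.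
    by rewrite raddf_sum big1 //= => y' _; rewrite rmorphM /= mP mulr0.
  case: i x => [|i] x; first by rewrite h0.
  rewrite hS // mcoeffD const0 addr0 raddf_sum big1 //= => x' _.
  by rewrite rmorphM /= mP mul0r.
have [/existsP[y hy]|/existsPn h0'] := boolP [exists y, (G i x y * H i y x)@_0%MM != 0];
    last first.
  move: Z0; rewrite /Z eqxx mcoeffB raddf_sum big1 => [|y _] /=.
    by rewrite mcoeff1 eqxx sub0r => /eqP; rewrite oppr_eq0 oner_eq0.
  by apply/eqP; have := h0' y; rewrite negbK.
exists y; move: hy; rewrite rmorphM /= mulf_eq0 negb_or => /andP[hG _].
by have /eqP := homogz_const (Gh i x y) hG; rewrite subr_eq0 => /eqP.
Qed.
End Shifts.

(** * Hilbert series and Hilbert polynomials *)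

Section HilbertSeries.
Implicit Types (Q : {poly int}) (m t a : nat).

(** The coefficient of degree [t] in the power series [Q / (1 - X) ^ m]. For [m = 0] the
    truncated predecessor makes ['C((s + m).-1, s)] equal to 1 at [s = 0] and to 0
    elsewhere, as it should. *)
Definition series_coef Q m t : int :=
  \sum_(0 <= j < t.+1) Q`_j * ('C((t - j + m).-1, t - j))%:Z.

Lemma series_coefB Q1 Q2 m t :
  series_coef (Q1 - Q2) m t = series_coef Q1 m t - series_coef Q2 m t.
Proof. by rewrite /series_coef -sumrB; apply: eq_bigr => j _; rewrite coefB mulrBl. Qed.

Lemma series_coefXn Q a m t :
  series_coef ('X^a * Q) m t = if (a <= t)%N then series_coef Q m (t - a) else 0.
Proof.
rewrite /series_coef; case: leqP => h; last first.
  rewrite big_nat big1 // => j /andP[_ hj].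
  by rewrite coefXnM ifT ?mul0r //; lia.
rewrite (big_cat_nat (n := a)) //=; last lia.
rewrite big_nat_cond big1 ?add0r => [|j /andP[/andP[_ ja] _]]; last first.
  by rewrite coefXnM ja mul0r.
rewrite -{1}[a]add0n big_addn -subSn //.
apply: eq_big_nat => j hj; rewrite coefXnM ifF ?addnK; last lia.
by rewrite -subnDA [(a + j)%N]addnC.
Qed.

(** Cancelling a factor [1 - X] is Pascal's rule. *)
Lemma series_coef_1subX Q m t : series_coef ((1 - 'X) * Q) m.+1 t = series_coef Q m t.
Proof.
rewrite mulrBl mul1r series_coefB -(expr1 'X) series_coefXn.
case: t => [|t] /=.
  by rewrite subr0 /series_coef !big_nat1 !bin0.
rewrite subn1 /= /series_coef [X in X - _]big_nat_recr //= [RHS]big_nat_recr //= addrAC -sumrB.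
rewrite subnn !bin0; congr (_ + _); apply: eq_big_nat => j hj.
rewrite -mulrBr; congr (_ * _).
have -> : (t.+1 - j = (t - j).+1)%N by rewrite subSn // -ltnS; case/andP: hj.
by rewrite !addnS !addSn /= binS PoszD addrK.
Qed.

Definition geometric_sum a : {poly int} := \sum_(i < a) 'X^i.

Lemma series_coef_geometric Q a m t :
  series_coef (Q - 'X^a * Q) m.+1 t = series_coef (Q * geometric_sum a) m t.
Proof.
rewrite -[RHS]series_coef_1subX; congr series_coef.
have e : 1 - 'X^a = (1 - 'X) * geometric_sum a :> {poly int}.
  rewrite -{1}(expr1n _ a) subrXX; congr (_ * _); apply: eq_bigr => i _.
  by rewrite expr1n mul1r.
by rewrite mulrCA -e mulrBr mulr1 (mulrC Q).
Qed.

Lemma series_coef0 Q t : series_coef Q 0 t = Q`_t.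
Proof.
rewrite /series_coef big_nat_recr //= subnn bin0 mulr1 big_nat big1 ?add0r // => j hj.
by rewrite addn0 bin_small ?mulr0 //; lia.
Qed.

Lemma geometric_sum1 a : (geometric_sum a).[1] = a%:Z.
Proof.
rewrite horner_sum (eq_bigr (fun=> 1)) => [|i _]; last by rewrite hornerXn expr1n.
by rewrite sumr_const card_ord -mulr_natr mul1r natz.
Qed.
End HilbertSeries.

Section HilbertPolynomial.
Variables (Q : {poly int}) (m : nat).

(** The Hilbert polynomial of [Q / (1 - X) ^ m.+1]: the product is [m`!] times the
    binomial coefficient ['C(t - j + m, m)], as a polynomial in [t]. *)
Definition hilbert_poly : {poly rat} :=
  \sum_(j < size Q) ((Q`_j)%:~R / (m`!)%:R) *:
    \prod_(i < m) ('X - (j%:R - i.+1%:R)%:P).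

Lemma prod_binomial s :
  \prod_(i < m) (s%:R + i.+1%:R : rat) = (m`!)%:R * ('C(s + m, s))%:R.
Proof.
apply: (@mulIf _ (s`!)%:R); first by rewrite pnatr_eq0 -lt0n fact_gt0.
have e : (m`! * 'C(s + m, s) * s`! = (s + m)`!)%N.
  by rewrite -(bin_fact (leq_addr m s)) addKn; nia.
rewrite -!natrM {}e.
elim: m => [|l IH]; first by rewrite big_ord0 addn0 mul1r.
rewrite big_ord_recr /= mulrAC IH addnS factS natrM mulrC -natrD.
by rewrite addnS.
Qed.

Lemma hilbert_polyE t : (size Q <= t)%N -> hilbert_poly.[t%:R] = (series_coef Q m.+1 t)%:~R.
Proof.
move=> ht; rewrite horner_sum /series_coef.
rewrite (big_cat_nat (n := size Q)) //=; last exact: leqW.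
rewrite [X in _ + X]big_nat_cond [X in _ + X]big1 ?addr0 => [|j /andP[/andP[h _] _]].
  rewrite big_mkord rmorph_sum; apply: eq_bigr => j _ /=.
  rewrite hornerZ horner_prod.
  have jt : (j <= t)%N by apply: leq_trans ht; apply: ltnW.
  rewrite (eq_bigr (fun i : 'I_m => (t - j)%:R + i.+1%:R)) => [|i _]; last first.
    by rewrite hornerXsubC opprB addrCA addrC natrB // -addrA [- _ + _]addrC addrA.
  rewrite prod_binomial mulrA divfK ?pnatr_eq0 -?lt0n ?fact_gt0 //.
  by rewrite addnS /= intrM.
by rewrite nth_default ?mul0r.
Qed.

Lemma hilbert_poly_lead : Q.[1] != 0 ->
  [/\ hilbert_poly != 0, (size hilbert_poly).-1 = m
    & (m`!)%:R * lead_coef hilbert_poly = (Q.[1])%:~R].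
Proof.
move=> Q1; pose Pj (j : nat) : {poly rat} := \prod_(i < m) ('X - (j%:R - i.+1%:R)%:P).
have szP j : size (Pj j) = m.+1.
  by rewrite /Pj -(big_map (fun i : 'I_m => j%:R - i.+1%:R) predT (fun c => 'X - c%:P))
     size_prod_XsubC size_map
     -[index_enum _]/(index_enum 'I_m) /index_enum -enumT size_enum_ord.
have coefP j : (Pj j)`_m = 1.
  have : Pj j \is monic by apply: monic_prod => i _; apply: monicXsubC.
  by rewrite monicE lead_coefE szP => /eqP.
have szp : (size hilbert_poly <= m.+1)%N.
  apply: (leq_trans (size_sum _ _ _)); apply/bigmax_leqP => j _.
  by rewrite (leq_trans (size_scale_leq _ _)) // -/(Pj j) szP.
have cm : hilbert_poly`_m = (Q.[1])%:~R / (m`!)%:R.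
  rewrite coef_sum horner_coef rmorph_sum mulr_suml; apply: eq_bigr => j _ /=.
  by rewrite coefZ -/(Pj j) coefP mulr1 expr1n mulr1.
have fm : (m`!)%:R != 0 :> rat by rewrite pnatr_eq0 -lt0n fact_gt0.
have cm0 : hilbert_poly`_m != 0 by rewrite cm mulf_neq0 ?invr_eq0 // intr_eq0.
have sz : size hilbert_poly = m.+1.
  by apply/eqP; rewrite eqn_leq szp ltnNge; apply: contra cm0 => h; rewrite nth_default.
split; first by rewrite -size_poly_eq0 sz.
  by rewrite sz.
by rewrite lead_coefE sz /= cm mulrC divfK.
Qed.
End HilbertPolynomial.

(** * Hilbert functions of quotients *)

Section GradedDim.
Variables (k : fieldType) (r : nat).
Local Notation R := {mpoly k[r]}.
Implicit Types (J : R -> Prop) (p q : R) (t a : nat) (Q : {poly int}).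

Definition lincomb h (b : 'I_h -> R) (c : 'rV[k]_h) : R := \sum_i c 0 i *: b i.

Lemma lincombD h b (c c' : 'rV_h) : lincomb b (c + c') = lincomb b c + lincomb b c'.
Proof. by rewrite /lincomb -big_split; apply: eq_bigr => i _; rewrite mxE scalerDl. Qed.

Lemma lincombB h b (c c' : 'rV_h) : lincomb b (c - c') = lincomb b c - lincomb b c'.
Proof. by rewrite /lincomb -sumrB; apply: eq_bigr => i _; rewrite !mxE scalerBl. Qed.

Lemma lincomb_mul h h' b (c : 'rV_h) (M : 'M_(h, h')) :
  lincomb b (c *m M) = \sum_j c 0 j *: lincomb b (row j M).
Proof.
rewrite /lincomb; under eq_bigr do rewrite mxE scaler_suml.
rewrite exchange_big; apply: eq_bigr => j _; rewrite scaler_sumr.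
by apply: eq_bigr => i _; rewrite scalerA mxE.
Qed.

Lemma lincomb_homog h b (c : 'rV_h) t :
  (forall i, b i \is t.-homog) -> lincomb b c \is t.-homog.
Proof. by move=> hb; apply: rpred_sum => i _; apply: rpredZ. Qed.

Lemma graded_dimP J t h : graded_dim J t h <-> exists b : 'I_h -> R,
  [/\ forall i, b i \is t.-homog,
      forall c : 'rV[k]_h, J (lincomb b c) -> c = 0
    & forall p, p \is t.-homog -> exists c, J (p - lincomb b c)].
Proof.
split=> -[b [hb ind span]]; exists b; split=> //.
- move=> c hc; apply/rowP => i; rewrite mxE.
  exact: (ind (fun i => c 0 i) hc i).
- move=> p /span[c hc]; exists (\row_i c i); rewrite /lincomb.
  by under eq_bigr do rewrite mxE.
- move=> c hc i; have := ind (\row_i c i); rewrite /lincomb.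
  under eq_bigr do rewrite mxE.
  by move=> /(_ hc)/rowP/(_ i); rewrite !mxE.
- by move=> p /span[c hc]; exists (fun i => c 0 i).
Qed.

Lemma graded_dim_ext J J' t h : (forall p, J p <-> J' p) ->
  graded_dim J t h -> graded_dim J' t h.
Proof.
move=> e [b [hb ind span]]; exists b; split=> // [c /e|p /span[c /e]]; first exact: ind.
by exists c.
Qed.

Section Add.
Variables (J : R -> Prop) (D : R) (l : nat).
Hypotheses (hJ : homog_ideal J) (hD : D \is l.-homog).
Let I p := J (p * D).
Let L p := exists x, J (p - x * D).

Lemma graded_dim_add_small t h : (t < l)%N -> graded_dim J t h -> graded_dim L t h.
Proof.
move=> ta /graded_dimP[b [hb ind span]]; apply/graded_dimP; exists b; split=> //.
  move=> c [x /(homog_ideal_hpart hJ t)]; rewrite raddfB /= mulrC.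
  rewrite (pihomog_dE (lincomb_homog c hb)).
  rewrite -[pihomog _ _ _]/(hpart t _) (hpartM t x (a := Posz l) hD).
  have -> : (t%:Z - l%:Z = Negz (l - t).-1) by rewrite NegzE; lia.
  by rewrite /= mulr0 subr0; exact: ind.
by move=> p /span[c hc]; exists c, 0; rewrite mul0r subr0.
Qed.

(** Multiplication by [D] embeds [R/(J : D)], shifted by the degree of [D], into [R/J],
    with cokernel [R/(J + (D))]. *)
Lemma graded_dim_add t h1 h2 : graded_dim J (l + t) h1 -> graded_dim I t h2 ->
  exists2 h, graded_dim L (l + t) h & (h1 = h + h2)%N.
Proof.
move=> /graded_dimP[b [hb ind span]] /graded_dimP[b' [hb' ind' span']].
have [w hw] : exists w : 'I_h2 -> 'rV_h1, forall j, J (b' j * D - lincomb b (w j)).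
  have h j : exists c, J (b' j * D - lincomb b c).
    by apply: span; rewrite mulrC; apply: dhomogM.
  pose c j := constructive_indefinite_description _ (h j).
  by exists (fun j => proj1_sig (c j)) => j; exact: (proj2_sig (c j)).
pose W := \matrix_j w j.
have hW (x : 'rV_h2) : J (lincomb b' x * D - lincomb b (x *m W)).
  rewrite lincomb_mul mulr_suml -sumrB.
  apply: (big_ind J) => [||j _]; [exact: homog_ideal0|exact: homog_idealD|].
  by rewrite rowK -scalerAl -scalerBr -mul_mpolyC; apply: (homog_idealM hJ).
have rW : \rank W = h2.
  apply/eqP; change (row_free W); apply/inj_row_free => x xW; apply: ind'.
  by have := hW x; rewrite xW /lincomb [X in _ - X]big1 ?subr0 // => i _;
     rewrite mxE scale0r.
(* In the coordinates given by b, the multiples of D fill the row space of W;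
   a complement of it provides a basis modulo L. *)
pose C := row_base (W^C)%MS.
have rC : \rank (W^C)%MS = (h1 - h2)%N by rewrite mxrank_compl rW.
exists (\rank (W^C)%MS); last by rewrite rC subnK // -rW rank_leq_col.
apply/graded_dimP; exists (fun j => lincomb b (row j C)).
have eC (c : 'rV_(\rank (W^C)%MS)) :
    lincomb (fun j => lincomb b (row j C)) c = lincomb b (c *m C).
  by rewrite lincomb_mul.
split.
- by move=> j; apply: lincomb_homog.
- move=> c; rewrite eC => -[q /(homog_ideal_hpart hJ (l + t)%N)]; rewrite raddfB /=.
  rewrite (pihomog_dE (lincomb_homog _ hb)).
  rewrite -[pihomog _ _ (q * D)]/(hpart (l + t)%N _) mulrC (hpartM _ q (a := Posz l) hD).
  have -> : ((l + t)%N%:Z - l%:Z = t%:Z) by rewrite PoszD addrAC subrr add0r.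
  rewrite mulrC => h.
  have [x hx] := span' _ (pihomogP mdeg t q).
  have {}hx : J (lincomb b (c *m C) - lincomb b (x *m W)).
    have -> : lincomb b (c *m C) - lincomb b (x *m W) =
      (lincomb b (c *m C) - hpart t q * D) + ((hpart t q - lincomb b' x) * D
        + (lincomb b' x * D - lincomb b (x *m W))).
      by rewrite mulrBl [X in _ = _ + X]addrA subrK addrA subrK.
    by apply: (homog_idealD hJ) => //; apply: (homog_idealD hJ).
  move: hx; rewrite -lincombB => /ind/eqP; rewrite subr_eq0 => /eqP e.
  have : (c *m C <= W :&: W^C)%MS.
    rewrite sub_capmx {1}e submxMl.
    by rewrite (submx_trans (submxMl _ _)) // /C eq_row_base.
  rewrite capmx_compl submx0 => /eqP cC0.
  have fC : row_free C by rewrite /row_free /C eq_row_base.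
  by apply/eqP; rewrite -(mulmx_free_eq0 _ fC); apply/eqP.
- move=> p /span[c hc].
  have : (c <= W + W^C)%MS by rewrite submx_full // addsmx_compl_full.
  case/sub_addsmxP => -[x y] /= ec.
  have /submxP[z ez] : (y *m W^C <= C)%MS by rewrite /C eq_row_base submxMl.
  exists z, (lincomb b' x); rewrite eC -ez.
  have -> : p - lincomb b (y *m W^C)%MS - lincomb b' x * D =
      (p - lincomb b c) - (lincomb b' x * D - lincomb b (x *m W)).
    by rewrite ec lincombD opprB opprD [RHS]addrACA addrC; ring.
  by apply: (homog_idealB hJ).
Qed.
End Add.

(** Regular elements act on a series [Q / (1 - X) ^ m] by multiplying [Q] and lowering
    [m], which makes the pair [(Q, m)] convenient for inductions. *)
Definition has_hilbert_series J Q m := forall t,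
  exists2 h, graded_dim J t h & h%:Z = series_coef Q m t.

Lemma has_hilbert_series_ext J J' Q m : (forall p, J p <-> J' p) ->
  has_hilbert_series J Q m -> has_hilbert_series J' Q m.
Proof. by move=> e H t; have [h hd he] := H t; exists h => //; apply: graded_dim_ext hd. Qed.

Lemma hilbert_series_add J D l Q1 Q2 m : homog_ideal J -> D \is l.-homog ->
  has_hilbert_series J Q1 m -> has_hilbert_series (fun p => J (p * D)) Q2 m ->
  has_hilbert_series (fun p => exists x, J (p - x * D)) (Q1 - 'X^l * Q2) m.
Proof.
move=> hJ hD H1 H2 t; have [h1 d1 e1] := H1 t; rewrite series_coefB series_coefXn.
case: leqP => lt; last first.
  by exists h1; [exact: graded_dim_add_small hD _ _ lt d1 | rewrite subr0].
have [h2 d2 e2] := H2 (t - l)%N; rewrite -(subnKC lt) in d1.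
have [h hd e] := graded_dim_add hJ hD d1 d2.
rewrite subnKC // in hd; exists h => //.
by rewrite -e1 -e2 e PoszD addrK.
Qed.

Lemma hilbert_series_regular J D l Q m : homog_ideal J -> D \is l.-homog ->
  (forall p, J (p * D) <-> J p) -> has_hilbert_series J Q m.+1 ->
  has_hilbert_series (fun p => exists x, J (p - x * D)) (Q * geometric_sum l) m.
Proof.
move=> hJ hD reg H t.
have [|h hd e] := @hilbert_series_add J D l Q Q m.+1 hJ hD H _ t.
  by apply: has_hilbert_series_ext H => p; split=> /reg.
by exists h => //; rewrite e series_coef_geometric.
Qed.

(** A nonzero graded module of finite length has no regular element of positive
    degree: its Hilbert function would be nondecreasing along multiples of that
    degree, from a positive value in degree 0. *)
Lemma finite_length_not_regular J D l Q : homog_ideal J -> D \is l.-homog -> (0 < l)%N ->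
  (forall p, J (p * D) <-> J p) -> has_hilbert_series J Q 0 -> J 1.
Proof.
move=> hJ hD l0 reg H.
have step t : Q`_t <= Q`_(l + t).
  have [h1 d1 e1] := H (l + t)%N; have [h2 d2 e2] := H t.
  rewrite -!series_coef0 -e1 -e2.
  have [|h _ ->] := graded_dim_add hJ hD d1 (h2 := h2); last lia.
  by apply: graded_dim_ext d2 => p; split=> /reg.
have big j : Q`_0 <= Q`_(j * l).
  elim: j => [|j IH]; first by rewrite mul0n.
  by rewrite mulSn (le_trans IH).
have := big (size Q); rewrite [X in _ <= X]nth_default ?leq_pmulr //.
have [h [b [_ _ span]]] := H 0%N; rewrite series_coef0 => <-.
case: h b span => [|h] // b span _.
by have [c] := span 1 (dhomog1 _ _); rewrite big_ord0 subr0.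
Qed.

End GradedDim.

Lemma graded_dim_poly (k : fieldType) r t :
  @graded_dim k r (fun p => p = 0) t 'C((t + r).-1, t).
Proof.
case: r => [|r].
  have const (p : {mpoly k[0]}) : p = p@_0 *: 1.
    apply/mpolyP => m; have -> : m = 0%MM by apply/mnmP => -[].
    by rewrite mcoeffZ mcoeff1 eqxx mulr1.
  case: t => [|t].
    rewrite bin0; exists (fun=> 1); split=> [i|c|p _]; first exact: dhomog1.
      move=> /= /(congr1 (mcoeff 0%MM)); rewrite big_ord1 mcoeffZ mcoeff1 eqxx mulr1.
      by rewrite mcoeff0 => e i; rewrite ord1.
    by exists (fun=> p@_0); rewrite big_ord1 -const subrr.
  rewrite addn0 /= bin_small //; exists (fun=> 0); split=> [[]|c _ []|p hp] //.
  exists (fun=> 0); rewrite big_ord0 subr0 [p]const.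
  by rewrite (dhomog_nemf_coeff hp) ?scale0r //= mdeg0.
rewrite addnS /=; case: (dhomog_vecaxiom r k t) => v lin [w vK wK].
pose vL : {linear _ -> _} :=
  HB.pack_for {linear dhomog r.+1 k t -> 'rV[k]_('C(t + r, t))} v
    (GRing.isLinear.Build _ _ _ _ v lin).
have wlin (c : 'rV_('C(t + r, t))) :
    mpoly_of_dhomog (w c) = \sum_i c 0 i *: mpoly_of_dhomog (w (delta_mx 0 i)).
  have -> : w c = \sum_i c 0 i *: w (delta_mx 0 i).
    apply: (can_inj vK); rewrite wK -[v]/(vL : _ -> _) linear_sum [LHS]row_sum_delta.
    by apply: eq_bigr => i _; rewrite linearZ /= wK.
  by rewrite linear_sum; apply: eq_bigr => i _; rewrite linearZ.
exists (fun i => mpoly_of_dhomog (w (delta_mx 0 i))); split=> [i|c hc i|p hp].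
- exact: dhomog_is_dhomog.
- have w0 : w (\row_j c j) = 0.
    by apply: val_inj; rewrite [LHS]wlin -[RHS]hc; apply: eq_bigr => j _; rewrite mxE.
  have : v (w (\row_j c j)) = 0 by rewrite w0 -[v]/(vL : _ -> _) linear0.
  by rewrite wK => /rowP/(_ i); rewrite !mxE.
- exists (fun i => v (DHomog hp) 0 i).
  by rewrite -wlin vK subrr.
Qed.

Lemma hilbert_series_poly (k : fieldType) r : @has_hilbert_series k r (fun p => p = 0) 1 r.
Proof.
move=> t; exists 'C((t + r).-1, t); first exact: graded_dim_poly.
rewrite /series_coef big_nat_recl //= coef1 eqxx mul1r subn0 big1 ?addr0 // => j _.
by rewrite coef1 mul0r.
Qed.

Section Multiplicity.
Variables (k : fieldType) (r : nat) (J : {mpoly k[r]} -> Prop) (Q : {poly int}) (m : nat).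
(** The multiplicity is read off at [X = 1]. The hypothesis ensures that the order of
    the pole of [Q / (1 - X) ^ m] at 1 is exactly [m]. *)
Lemma hilbert_series_multiplicity : Q.[1] != 0 -> has_hilbert_series J Q m ->
  is_multiplicity J (Q.[1])%:~R.
Proof.
move=> Q1 H.
have [h hd he] : exists2 h, forall t, graded_dim J t (h t) &
    forall t, (h t)%:Z = series_coef Q m t.
  have ex t : exists h, graded_dim J t h /\ h%:Z = series_coef Q m t.
    by have [h ? ?] := H t; exists h.
  pose c t := constructive_indefinite_description _ (ex t).
  by exists (fun t => proj1_sig (c t)) => t; have [] := proj2_sig (c t).
case: m he => [|l] he.
  exists h, 0, (size Q); split=> // [t ht|].
    by rewrite horner0; have := he t; rewrite series_coef0 nth_default // => -[->].
  rewrite eqxx horner_coef rmorph_sum natr_sum; apply: eq_bigr => j _ /=.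
  by rewrite expr1n mulr1 -series_coef0 -he.
have [p0 sz lc] := hilbert_poly_lead l Q1.
exists h, (hilbert_poly Q l), (size Q); split=> // [t ht|].
  by rewrite hilbert_polyE // -he.
by rewrite (negPf p0) sz lc.
Qed.
End Multiplicity.

(** * Hilbert series of complete intersections *)

Section CompleteIntersection.
Variables (k : fieldType) (r n : nat) (d : 'I_n -> nat) (g : 'I_n -> {mpoly k[r]}).
Hypothesis homg : forall i, g i \is (d i).-homog.
Local Notation R := {mpoly k[r]}.

Lemma homog_ideal_of (P : pred 'I_n) : homog_ideal (ideal_of P g).
Proof.
split; [exact: ideal_of0|exact: ideal_ofD|exact: ideal_ofM|].
move=> a _ [c ->]; exists (fun j => hpart (a - (d j)%:Z) (c j)).
rewrite raddf_sum /=; apply: eq_bigr => j _.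
by rewrite mulrC (hpartM a (c j) (a := Posz (d j)) (homg j)) mulrC.
Qed.

Lemma ideal_of_sub (P P' : pred 'I_n) p :
  (forall j, P j -> P' j) -> ideal_of P g p -> ideal_of P' g p.
Proof.
by move=> h [c ->]; apply: ideal_of_sum => j /h Pj; apply/ideal_ofM/ideal_of_gen.
Qed.

Lemma ideal_ofU1 (x : 'I_n) p : ideal_of (fun j : 'I_n => (j < x.+1)%N) g p <->
  exists y, ideal_of (fun j : 'I_n => (j < x)%N) g (p - y * g x).
Proof.
split=> [[c ->]|[y hy]].
  exists (c x); rewrite (bigD1 x) //= addrC addrK; exists c.
  by apply: eq_bigl => j; rewrite ltnS ltn_neqAle andbC.
rewrite -[p](subrK (y * g x)); apply: ideal_ofD.
  by apply: ideal_of_sub hy => j; apply: ltnW.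
by apply/ideal_ofM/ideal_of_gen => /=.
Qed.

Hypothesis reg : regular_sequence g.

(** A homogeneous element of degree 0 is a constant: a unit generates the whole ring,
    and 0 is regular only modulo the whole ring. *)
Lemma regular_degree_gt0 i : (0 < d i)%N.
Proof.
rewrite lt0n; apply/negP => /eqP d0; have := homg i; rewrite d0 => hg.
have [reg1 proper] := reg; apply: proper.
pose c := (g i)@_0%MM.
have gi : g i = c%:MP.
  apply/mpolyP => m; rewrite mcoeffC; case: eqVneq => [->|m0]; first by rewrite mulr1.
  by rewrite mulr0 (dhomog_nemf_coeff hg) //= mdeg_eq0.
have [c0|c0] := eqVneq c 0.
  apply: (@ideal_of_sub (fun j : 'I_n => (j < i)%N)) => //; apply: reg1.
  by rewrite gi c0 mpolyC0 mulr0; exact: ideal_of0.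
have -> : 1 = (c^-1)%:MP * g i :> R by rewrite gi -mpolyCM mulVf.
by apply/ideal_ofM/ideal_of_gen.
Qed.

(** Each regular element of degree [d] multiplies the series by
    [1 - X ^ d = (1 - X) (1 + ... + X ^ (d - 1))]. Starting from [1 / (1 - X) ^ r], the
    exponent of the denominator cannot become negative, whence [i <= r]. *)
Lemma hilbert_series_partial i : (i <= n)%N -> (i <= r)%N /\
  has_hilbert_series (ideal_of (fun j : 'I_n => (j < i)%N) g)
       (\prod_(j < n | (j < i)%N) geometric_sum (d j)) (r - i).
Proof.
elim: i => [|i IH] hi.
  split=> //; rewrite subn0 big_pred0 //.
  apply: has_hilbert_series_ext (hilbert_series_poly k r) => p.
  split=> [->|[c ->]]; first exact: ideal_of0.
  by rewrite big_pred0.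
have [ir H] := IH (ltnW hi); pose x := Ordinal hi.
have regx p : ideal_of (fun j : 'I_n => (j < x)%N) g (p * g x) <->
              ideal_of (fun j : 'I_n => (j < x)%N) g p.
  split; first by case: reg => h _; exact: h.
  by move=> h; rewrite mulrC; apply: ideal_ofM.
(* If i = r the quotient by the first r elements has finite length, and no
   regular element of positive degree is left. *)
have {ir} lt_ir : (i < r)%N.
  rewrite ltn_neqAle ir andbT; apply/negP => /eqP e.
  have [_ proper] := reg; apply: proper.
  have z : (r - i = 0)%N by rewrite e subnn.
  rewrite z in H.
  have := finite_length_not_regular (homog_ideal_of _) (homg x) (regular_degree_gt0 x) regx H.
  exact: ideal_of_sub.
split=> //; rewrite -(subSS i r) (subSn lt_ir) in H.
have := hilbert_series_regular (homog_ideal_of _) (homg x) regx H.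
have -> : \prod_(j < n | (j < i.+1)%N) geometric_sum (d j) =
    (\prod_(j < n | (j < i)%N) geometric_sum (d j)) * geometric_sum (d x).
  rewrite (bigD1 x) //= mulrC; congr (_ * _); apply: eq_bigl => j.
  by rewrite [RHS]ltn_neqAle ltnS andbC.
by apply: has_hilbert_series_ext => p; split=> h; apply/(ideal_ofU1 x).
Qed.

Lemma hilbert_series_complete_intersection : (n <= r)%N /\
  has_hilbert_series (ideal_gen g) (\prod_j geometric_sum (d j)) (r - n).
Proof.
have [nr H] := hilbert_series_partial (leqnn n); split=> //.
rewrite (eq_bigl (fun j : 'I_n => (j < n)%N)) => [|j]; last by rewrite ltn_ord.
by apply: has_hilbert_series_ext H => p; split; apply: ideal_of_sub => // j _; exact: ltn_ord.
Qed.
End CompleteIntersection.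

(** * The bound *)

(** All degrees but the last are at most [e / 2], and [l.+1 <= 2 ^ l]. *)
Lemma prod_degrees_bound l e (d : 'I_l.+1 -> nat) :
  (forall j : 'I_l.+1, (j < l)%N -> (2 * d j <= e)%N) ->
  (l.+1 * \prod_j d j <= e ^ l * d ord_max)%N.
Proof.
move=> hd; rewrite big_ord_recr /= mulnA leq_mul2r; apply/orP; right.
apply: (@leq_trans (2 ^ l * \prod_(j < l) d (widen_ord (leqnSn l) j))).
  by rewrite leq_mul2r ltn_expl ?orbT.
have pc c : (c ^ l = \prod_(j < l) c)%N by rewrite prod_nat_const card_ord.
rewrite !pc -big_split /=.
by apply: leq_prod => j _; apply: hd => /=.
Qed.

Lemma prod_shifts_bound l e (dl : nat) (m : nat -> int) :
  (forall i, (1 <= i <= l.+1)%N -> 0 <= m i) ->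
  (forall i, (1 <= i <= l)%N -> m i <= (i * e)%N%:Z) ->
  m l.+1 <= (l.+1 * e)%N%:Z - dl%:Z ->
  \prod_(1 <= i < l.+2) m i <= (l`! * e ^ l)%N%:Z * ((l.+1 * e)%N%:Z - dl%:Z).
Proof.
move=> m0 mi ml; rewrite big_nat_recr //=; apply: ler_pM => //.
- by rewrite big_nat; apply: prodr_ge0 => i hi; apply: m0; lia.
- by apply: m0; lia.
have -> : (l`! * e ^ l)%N%:Z = \prod_(1 <= i < l.+1) (i * e)%N%:Z.
  rewrite -[RHS](big_morph Posz PoszM (erefl _)) big_split /=.
  by rewrite -fact_prod prod_nat_const_nat subSS subn0.
rewrite !big_nat; apply: ler_prod => i hi.
by rewrite m0 ?mi //; lia.
Qed.

(** With [n = l.+1], the shifts multiply to at most [l`! e^l (n e - d_n)]; after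
    division by [n`!] the bound reads [e^n - e^l d_n / n], and [prod_degrees_bound] says
    that [e^l d_n / n] is at least the product of the degrees. *)
Lemma multiplicity_bound l e (d : 'I_l.+1 -> nat) (m : nat -> int) :
  (forall j : 'I_l.+1, (j < l)%N -> (2 * d j <= e)%N) ->
  (forall i, (1 <= i <= l.+1)%N -> 0 <= m i) ->
  (forall i, (1 <= i <= l)%N -> m i <= (i * e)%N%:Z) ->
  m l.+1 <= (l.+1 * e)%N%:Z - (d ord_max)%:Z ->
  (\prod_(1 <= i < l.+2) m i)%:~R / ((l.+1)`!)%:R <=
    ((e ^ l.+1)%N%:Z - (\prod_j d j)%N%:Z)%:~R :> rat.
Proof.
move=> hd m0 mi ml; rewrite ler_pdivrMr; last by rewrite ltr0n fact_gt0.
rewrite -[((l.+1)`!)%:R]/((l.+1)`!%:Z%:~R) -intrM ler_int.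
apply: le_trans (prod_shifts_bound m0 mi ml) _.
have := prod_degrees_bound hd; rewrite factS expnS.
move: (\prod_j d j)%N (e ^ l)%N (d ord_max) (l`!) => p x y z h; nia.
Qed.

Lemma card_ord_lt n c : (c <= n)%N -> #|[set j : 'I_n | (j < c)%N]| = c.
Proof.
move=> cn; rewrite -sum1_card; transitivity (\sum_(j < c) 1)%N; last first.
  by rewrite sum1_card card_ord.
by rewrite (big_ord_widen n (fun=> 1%N) cn); apply: eq_bigl => j; rewrite inE.
Qed.

Lemma homog_ideal_colon (k : fieldType) (r n : nat) (d : 'I_n -> nat)
    (g : 'I_n -> {mpoly k[r]}) (K : {mpoly k[r]} -> Prop) :
  (forall i, g i \is (d i).-homog) -> homog_ideal K -> homog_ideal (colon K (ideal_gen g)).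
Proof.
move=> homg hK; split.
- by move=> q _; rewrite mul0r; apply: homog_ideal0.
- by move=> p q hp hq x Ix; rewrite mulrDl; apply: homog_idealD => //; [apply: hp|apply: hq].
- by move=> p q hq x Ix; rewrite -mulrA; apply: homog_idealM => //; apply: hq.
move=> a p hp _ [c ->]; rewrite mulr_sumr; apply: (big_ind K); first exact: homog_ideal0.
  exact: homog_idealD.
move=> j _; rewrite mulrCA; apply: homog_idealM => //.
have -> : hpart a p * g j = hpart (a + (d j)%:Z) (g j * p).
  by rewrite (hpartM _ p (a := Posz (d j)) (homg j)) addrK mulrC.
by apply: homog_ideal_hpart => //; rewrite mulrC; apply: hp; apply: ideal_of_gen.
Qed.

Theorem theorem4p3 (k : fieldType) (r n e : nat) (d : 'I_n -> nat)
    (g f : 'I_n -> {mpoly k[r]})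
    (phi : {set 'I_n} -> {set 'I_n} -> {mpoly k[r]})
    (F : gfree k r) (m : nat -> int)
    (I := ideal_gen g) (K := ideal_gen f) (J := colon K I) :
  (2 <= n)%N ->
  (forall i j : 'I_n, (i <= j)%N -> (d i <= d j)%N) ->
  (forall i, g i \is (d i).-homog) ->
  regular_sequence g ->
  (forall i, f i \is e.-homog) ->
  regular_sequence f ->
  (forall p, K p -> I p) ->
  koszul_comparison f g e d phi ->
  minimal (dual_mapping_cone f g e d phi) ->
  minimal_graded_free_resolution F J ->
  (forall i, (1 <= i <= n)%N -> minimal_shift F i (m i)) ->
  m n.-1 = (n.-1 * e)%N%:Z ->
  exists2 mu : rat, is_multiplicity J mu &
    (\prod_(1 <= i < n.+1) m i)%:~R / (n`!)%:R <= mu.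
Proof.
revert d g f phi I K J; case: n => [|l] d g f phi I K J; first by [].
set n := l.+1.
move=> n2 dmono homg regg homf regf KI [phi0 phih phic] minP [gF mF rF] hm hlast.
pose P := dual_mapping_cone f g e d phi.
have n0 : (0 < n)%N by [].
have hK : homog_ideal K := homog_ideal_of homf predT.
have hJ : homog_ideal J := homog_ideal_colon homg hK.
have gP : graded P by apply: cone_graded.
have rP : resolves P J by apply: cone_resolves.
have lower i (x : gbasis P i) : (1 <= i <= n)%N -> m i <= gshift x.
  move=> /hm[_ low]; have [y <-] := shift_transfer hJ gP gF minP rP rF x.
  exact: low.
have attained i : (1 <= i <= n)%N -> exists x : gbasis P i, gshift x = m i.
  by move=> /hm[[y <-] _]; exact: (shift_transfer hJ gF gP mF rF rP y).
have m_inr i (T : {set 'I_n}) : (1 <= i <= n)%N -> (#|T| + i = n.+1)%N ->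
    m i <= (n * e)%N%:Z - (\sum_(t in T) d t)%N%:Z.
  move=> hi hT; have hT' : (#|T| + i == n.+1)%N && (T != set0).
    rewrite hT eqxx -card_gt0; lia.
  by have := lower i (inr (exist _ T hT')) hi.
have m_inl i : (1 <= i <= l)%N -> m i <= (i * e)%N%:Z.
  move=> hi; pose S := [set j : 'I_n | (j < n - i)%N].
  have cS : #|S| = (n - i)%N by apply: card_ord_lt; rewrite leq_subr.
  have hS : (#|S| + i == n)%N && (S != set0).
    rewrite -card_gt0 cS; apply/andP; split; [apply/eqP|]; rewrite /n; lia.
  have hi' : (1 <= i <= n)%N by rewrite /n; lia.
  by have := lower i (inl (exist _ S hS)) hi'.
have lt_l1 : (l.-1 < n)%N by rewrite /n; lia.
pose z : 'I_n := Ordinal lt_l1.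
have zmax : z != ord_max by rewrite -val_eqE /=; lia.
(* The basis element of degree n - 1 indexed by the two last generators has shift
   n * e - d_(n-1) - d_n, which is at least m_(n-1) = (n - 1) * e. *)
have d_pair : (d z + d ord_max <= e)%N.
  have := m_inr l [set z; ord_max]; rewrite cards2 zmax big_setU1 ?inE //= big_set1.
  rewrite [m l]hlast /n; move: (d z) (d ord_max) => a b.
  have : (1 <= l)%N by [].
  rewrite mulSn /=; lia.
have d_le j : (d j <= e)%N.
  by apply: leq_trans (leq_trans (leq_addl _ _) d_pair); apply: dmono; rewrite -ltnS.
have sum_d (T : {set 'I_n}) : (\sum_(t in T) d t <= n * e)%N.
  apply: (@leq_trans (\sum_(t in T) e)); first exact: leq_sum.
  by rewrite sum_nat_const leq_mul2r -[X in (_ <= X)%N]card_ord -cardsT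
     subset_leq_card ?orbT ?subsetT.
have m_ge0 i : (1 <= i <= n)%N -> 0 <= m i.
  case/attained => -[S|T] <- //=.
  by rewrite subr_ge0 lez_nat sum_d.
have [nr HK] := hilbert_series_complete_intersection homf regf.
have [_ HI] := hilbert_series_complete_intersection homg regg.
pose s := (n * e - \sum_(t in [set: 'I_n]) d t)%N.
have homD : phi setT setT \is s.-homog.
  have := phih setT setT erefl; rewrite cardsT card_ord.
  by rewrite subzn ?sum_d.
have HJ : has_hilbert_series J
    (\prod_(j < n) geometric_sum e - 'X^s * \prod_(j < n) geometric_sum (d j)) (r - n).
  apply: (@has_hilbert_series_ext _ _ (fun p => exists x, K (p - x * phi setT setT))).
    by move=> p; split=> h; apply/(@colonP _ _ _ f g phi).
  apply: hilbert_series_add => //; apply: has_hilbert_series_ext HI => p; split=> h.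
    by apply: (@Delta_colon _ _ _ f g phi).
  exact: (@colon_Delta_sub _ _ _ f g phi).
have d_half (j : 'I_n) : (j < l)%N -> (2 * d j <= e)%N.
  move=> jl; have h1 : (d j <= d z)%N by apply: dmono => /=; lia.
  have h2 : (d z <= d ord_max)%N by apply: dmono => /=; lia.
  lia.
set Q := (_ - _) in HJ.
have Q1 : Q.[1] = (e ^ n)%N%:Z - (\prod_j d j)%N%:Z.
  rewrite /Q hornerD hornerN hornerM hornerXn expr1n mul1r !horner_prod.
  under eq_bigr do rewrite geometric_sum1.
  under [X in _ - X]eq_bigr do rewrite geometric_sum1.
  by rewrite -!(big_morph Posz PoszM (erefl _)) prod_nat_const card_ord.
exists (Q.[1])%:~R.
  apply: (hilbert_series_multiplicity _ HJ); rewrite Q1.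
  have e0 : (0 < e)%N := regular_degree_gt0 homf regf ord_max.
  have := prod_degrees_bound d_half; rewrite subr_eq0 eqz_nat /n expnS.
  have := d_le ord_max; have : (0 < e ^ l)%N by rewrite expn_gt0 e0.
  move: n2; rewrite /n; move: (\prod_j d j)%N (e ^ l)%N (d ord_max) => p x y; nia.
rewrite Q1; apply: multiplicity_bound => //.
have := m_inr n [set ord_max]; rewrite cards1 big_set1 addnC addn1 leqnn /=.
by apply.
Qed.
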